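(* There is an algorithm that, given $m \in \mathbb{N}$ with $m \geq 3$, Boolean variables $t_0, \dotsc, t_{m-1}$ and arrival times $a : \{t_0, \dotsc, t_{m-1}\} \to \mathbb{N}$, computes in time $\mathcal{O}(m^2 \log_2 m)$ a Boolean circuit over $\{\land,\lor\}$ realizing the \textsc{And}-\textsc{Or} path $t_0 \land (t_1 \lor (t_2 \land ( \dotsb t_{m-1}) \dotsb ))$ with delay at most $\log_2 W + \log_2 \log_2 m + \log_2 \log_2 \log_2 m + 4.3$, where $W := \sum_{i=0}^{m-1} 2^{a(t_i)}$.
   Context: The \textsc{And}-\textsc{Or} path $t_0 \land (t_1 \lor (t_2 \land ( \dotsb t_{m-1}) \dotsb ))$ is the function $g(t)$ defined recursively by $g(t) = g^*(t) = t_0$ for $m = 1$ and, for $m>1$, $g(t) = t_0 \land g^*((t_1,\dotsc,t_{m-1}))$, $g^*(t) = t_0 \lor g((t_1,\dotsc,t_{m-1}))$. A Boolean circuit over $\{\land,\lor\}$ is a directed acyclic graph whose indegree-0 nodes (inputs) are labeled by Boolean variables, with a unique outdegree-0 node (output) of indegree 1, and all other nodes are gates of indegree exactly 2 labeled \textsc{And} or \textsc{Or}; it realizes a Boolean function if its output computes that function for all input values. The delay of an input $x$ is $a(x)$ plus the maximum number of gates on any directed path starting at $x$; the delay of the circuit is the maximum delay over its inputs. *)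

(* Defs.v *)
From HB Require Import structures.
From mathcomp Require Import all_boot all_order all_algebra.
From mathcomp Require Import reals exp.

Set Implicit Arguments.
Unset Strict Implicit.
Unset Printing Implicit Defensive.

(* Random access machine of Cook and Reckhow with the uniform cost criterion:
   each executed instruction costs one step.  The registers X_0, X_1, ... hold
   natural numbers and are initially 0; subtraction is truncated.  There is
   deliberately no multiplication or shift: at unit cost on unbounded registers
   it would make the model unreasonably powerful. *)
Inductive instr : Type :=
  | IConst of nat & nat          (* X_i <- c *)
  | IAdd of nat & nat & nat      (* X_i <- X_j + X_k *)
  | ISub of nat & nat & nat      (* X_i <- X_j - X_k *)
  | ILoad of nat & nat           (* X_i <- X_(X_j) *)
  | IStore of nat & nat          (* X_(X_i) <- X_j *)
  | IJumpPos of nat & nat        (* the first argument is the target l: goto l if X_j > 0 *)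
  | IRead of nat                 (* X_i <- next input number *)
  | IPrint of nat.               (* append X_i to the output *)

Definition program := seq instr.

Record state := State {
  pc : nat;
  regs : nat -> nat;
  input : seq nat;
  output : seq nat
}.

Definition set_reg (X : nat -> nat) (i c : nat) : nat -> nat :=
  fun j => if j == i then c else X j.

(* Reading beyond the end of the input yields 0. *)
Definition exec (ins : instr) (s : state) : state :=
  let: State l X inp out := s in
  match ins with
  | IConst i c => State l.+1 (set_reg X i c) inp out
  | IAdd i j k => State l.+1 (set_reg X i (X j + X k)) inp out
  | ISub i j k => State l.+1 (set_reg X i (X j - X k)) inp out
  | ILoad i j => State l.+1 (set_reg X i (X (X j))) inp out
  | IStore i j => State l.+1 (set_reg X (X i) (X j)) inp out
  | IJumpPos l' j => State (if 0 < X j then l' else l.+1) X inp out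
  | IRead i => State l.+1 (set_reg X i (head 0 inp)) (behead inp) out
  | IPrint i => State l.+1 X inp (rcons out (X i))
  end.

(* The machine halts when the program counter leaves the program; a halted
   state is a fixed point of [step]. *)
Definition step (P : program) (s : state) : state :=
  if onth P (pc s) is Some ins then exec ins s else s.

Definition halted (P : program) (s : state) : bool := size P <= pc s.

Definition init (inp : seq nat) : state := State 0 (fun=> 0) inp [::].

Definition outputs_within (P : program) (inp : seq nat) (T : nat)
    (out : seq nat) : Prop :=
  let s := iter T (step P) (init inp) in halted P s /\ output s = out.

Inductive label (m : nat) : Type :=
  | Input of 'I_m
  | And
  | Or
  | Output.
Arguments And {m}.
Arguments Or {m}.
Arguments Output {m}.

Definition is_input m (l : label m) : bool :=
  if l is Input _ then true else false.

Definition is_gate m (l : label m) : bool :=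
  match l with And | Or => true | _ => false end.

Definition is_output m (l : label m) : bool :=
  if l is Output then true else false.

Definition label_indegree m (l : label m) : nat :=
  match l with Input _ => 0 | And | Or => 2 | Output => 1 end.

(* Labelled digraphs, without parallel arcs, on the nodes 0, ..., nnodes - 1. *)
Record digraph (m : nat) := Digraph {
  nnodes : nat;
  node_label : 'I_nnodes -> label m;
  arc : rel 'I_nnodes
}.

Definition indegree m (C : digraph m) (v : 'I_(nnodes C)) : nat :=
  #|[pred u | arc u v]|.

Definition outdegree m (C : digraph m) (v : 'I_(nnodes C)) : nat :=
  #|[pred u | arc v u]|.

Definition acyclic m (C : digraph m) : Prop :=
  forall u v : 'I_(nnodes C), arc u v -> ~~ connect (@arc m C) v u.

Definition is_circuit m (C : digraph m) : Prop :=
  [/\ acyclic C,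
      forall v : 'I_(nnodes C), indegree v = label_indegree (node_label v),
      forall v : 'I_(nnodes C), is_output (node_label v) = (outdegree v == 0) &
      #|[pred v : 'I_(nnodes C) | outdegree v == 0]| = 1].

(* By acyclicity, a circuit has exactly one valuation for each [x]. *)
Definition is_valuation m (C : digraph m) (x : 'I_m -> bool)
    (val : 'I_(nnodes C) -> bool) : Prop :=
  forall v : 'I_(nnodes C),
    match node_label v with
    | Input i => val v = x i
    | And => val v = [forall (u | arc u v), val u]
    | Or => val v = [exists (u | arc u v), val u]
    | Output => forall u, arc u v -> val v = val u
    end.

Definition realizes m (C : digraph m) (f : ('I_m -> bool) -> bool) : Prop :=
  forall x : 'I_m -> bool, exists2 val : 'I_(nnodes C) -> bool,
    is_valuation x val &
    forall v : 'I_(nnodes C), is_output (node_label v) -> val v = f x.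

(* A path starting at [v] is [v :: p] with [path arc v p]; in an acyclic digraph
   on n nodes every such [p] has size less than n. *)
Definition max_gates_from m (C : digraph m) (v : 'I_(nnodes C)) : nat :=
  \max_(p : (nnodes C).-bseq 'I_(nnodes C) | path (@arc m C) v p)
     count (fun u => is_gate (node_label u)) (v :: p).

Definition node_delay m (a : 'I_m -> nat) (C : digraph m)
    (v : 'I_(nnodes C)) : nat :=
  if node_label v is Input i then a i + max_gates_from v else 0.

Definition delay m (a : 'I_m -> nat) (C : digraph m) : nat :=
  \max_(v : 'I_(nnodes C) | is_input (node_label v)) node_delay a v.

(* The functions g and g^*; the value at the empty sequence is irrelevant. *)
Fixpoint and_or_path (t : seq bool) : bool :=
  match t with
  | [::] => true
  | [:: t0] => t0
  | t0 :: t' => t0 && or_and_path t'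
  end
with or_and_path (t : seq bool) : bool :=
  match t with
  | [::] => false
  | [:: t0] => t0
  | t0 :: t' => t0 || and_or_path t'
  end.

Definition and_or_fun m (x : 'I_m -> bool) : bool :=
  and_or_path [seq x i | i <- enum 'I_m].

Definition encode_instance m (a : 'I_m -> nat) : seq nat :=
  m :: [seq a i | i <- enum 'I_m].

Definition encode_label m (l : label m) : seq nat :=
  match l with
  | Input i => [:: 0; val i]
  | And => [:: 1]
  | Or => [:: 2]
  | Output => [:: 3]
  end.

(* Node by node, the label followed by the list, in any order, of the
   predecessors.  For circuits this is uniquely decodable, since the label
   determines the number of predecessors. *)
Definition encodes m (out : seq nat) (C : digraph m) : Prop :=
  exists2 preds : 'I_(nnodes C) -> seq 'I_(nnodes C),
    forall v, uniq (preds v) /\ preds v =i [pred u | arc u v] &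
    out = flatten [seq encode_label (node_label v) ++ map val (preds v)
                  | v <- enum 'I_(nnodes C)].

Definition log2 (R : realType) (x : R) : R := (ln x / ln 2)%R.

(* Main.v *)
Require Import Defs.
From HB Require Import structures.
From mathcomp Require Import all_boot all_order all_algebra.
From mathcomp Require Import reals exp.
From mathcomp Require Import zify lra ring.

Set Implicit Arguments.
Unset Strict Implicit.
Unset Printing Implicit Defensive.

(* Write [h t = t_0 /\ h* t'] and [h* t = t_0 \/ h t'] for alternating chains,
   and consider the extended paths [F(S, I) = AND(S) /\ h*(I)] with their duals.
   If [S] weighs more than [2^(d-1)], sorting [S] by weight yields a prefix of
   weight exactly [2^(d-1)], which is split off.  Otherwise, by distributivity,
     F(S, t_0 ... t_(n-1)) =
       F(S, t_0 ... t_(2k-1)) /\ F*({t_0, t_2, ..., t_(2k)}, t_(2k+1) ... t_(n-1)).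
   With weights [w = 2^a], delay [d] suffices as soon as
     w(S) + 2 (d - 1) w(t_0 ... t_(n-2)) + 2 w(t_(n-1)) <= 2^d:
   taking the largest [k] for which the left part satisfies this for [d - 1], the
   right part does as well.  The last variable of a chain being cheap, no loss
   occurs when the cut falls next to a heavy variable.

   Arrival times are shifted so that the largest one is [L], with
   [2 m <= 2^L < 4 m], and truncated at 0; this adds at most [m] to the total
   weight.  Hence the least [d] for the whole path is [O(log m)], which bounds the
   running time, and the condition for [d] yields the claimed delay.  The machine
   produces the formula tree in breadth-first order. *)

(** * Structured programs for the random access machine *)

(** The arrival times are arbitrary, so without rescaling neither the search for [d] nor the numbers
    handled could be bounded in terms of [m]. After it every weight is at most [2^L < 4 m] and the
    total is below [4 m^2]. Hence [d = O(log m)], and the factor [2 (d - 1)] in the condition costs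
    only [log2 log2 m] plus a constant. Of the 4.3 in the claim, one unit is spent because the least
    [d] exceeds the last failing value by one; the remaining 3.3 enter as the factor 9.8, slightly
    less than [2^3.3]. The machine has no multiplication. Weights are read from a table of powers of
    two, every product has a factor that is [O(log m)] and is formed by repeated addition, and
    symmetric variables are ordered by bucket sort over the [L + 1] possible arrival times. The
    running time is amortized: each item carries a potential, and a split releases at least as much
    of it as the item has variables. This gives [O(m L^3)] for the tree, and [L^2 = O(m)] turns it
    into the required bound. *)

Record store := Store {
  var : nat -> nat;
  arr : nat -> nat -> nat;
  sin : seq nat;
  sout : seq nat
}.

Definition setv (s : store) x a := Store (set_reg (var s) x a) (arr s) (sin s) (sout s).

Definition seta (s : store) q i a :=
  Store (var s) (fun r j => if (r == q) && (j == i) then a else arr s r j)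
    (sin s) (sout s).

(* [Loop x c] runs [c] as often as the initial value of [x] says, while [x]
   counts down to 0; [wf] below forbids [c] to write [x]. *)
Inductive cmd : Type :=
  | Skip
  | Const of nat & nat
  | Plus of nat & nat & nat
  | Monus of nat & nat & nat
  | Get of nat & nat & nat
  | Put of nat & nat & nat
  | Read of nat
  | Print of nat
  | Seq of cmd & cmd
  | If of nat & cmd & cmd
  | Loop of nat & cmd.

Fixpoint run (c : cmd) (s : store) : store :=
  match c with
  | Skip => s
  | Const x n => setv s x n
  | Plus x y z => setv s x (var s y + var s z)
  | Monus x y z => setv s x (var s y - var s z)
  | Get x q y => setv s x (arr s q (var s y))
  | Put q y x => seta s q (var s y) (var s x)
  | Read x => Store (set_reg (var s) x (head 0 (sin s))) (arr s) (behead (sin s)) (sout s)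
  | Print x => Store (var s) (arr s) (sin s) (rcons (sout s) (var s x))
  | Seq c1 c2 => run c2 (run c1 s)
  | If x c1 c2 => if 0 < var s x then run c1 s else run c2 s
  | Loop x c1 => iter (var s x) (fun s => run c1 (setv s x (var s x).-1)) s
  end.

(** The constants count emitted instructions. An array access is six for the address and one for the
    access. A loop round adds the test, the decrement and the jump back; leaving the loop takes two
    jumps. *)
Fixpoint cost (c : cmd) (s : store) : nat :=
  match c with
  | Skip => 0
  | Get _ _ _ | Put _ _ _ => 7
  | Seq c1 c2 => cost c1 s + cost c2 (run c1 s)
  | If x c1 c2 => if 0 < var s x then (cost c1 s).+1 else (cost c2 s).+2
  | Loop x c1 =>
      (iter (var s x) (fun p => let s' := setv p.1 x (var p.1 x).-1 in
          (run c1 s', p.2 + (cost c1 s' + 3))) (s, 0)).2 + 2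
  | _ => 1
  end.

Fixpoint writes (c : cmd) : seq nat :=
  match c with
  | Const x _ | Plus x _ _ | Monus x _ _ | Get x _ _ | Read x => [:: x]
  | Seq c1 c2 | If _ c1 c2 => writes c1 ++ writes c2
  | Loop x c1 => x :: writes c1
  | _ => [::]
  end.

Fixpoint awrites (c : cmd) : seq nat :=
  match c with
  | Put q _ _ => [:: q]
  | Seq c1 c2 | If _ c1 c2 => awrites c1 ++ awrites c2
  | Loop _ c1 => awrites c1
  | _ => [::]
  end.

Fixpoint silent (c : cmd) : bool :=
  match c with
  | Read _ | Print _ => false
  | Seq c1 c2 | If _ c1 c2 => silent c1 && silent c2
  | Loop _ c1 => silent c1
  | _ => true
  end.

(* Scalar j < 48 is register j, entry i of array q < 16 is register
   64 + 16 i + q, register 50 holds 1, and registers 48, 49 are scratch. *)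
Definition cell q i := 64 + 16 * i + q.

(** * Compilation to machine code and its correctness *)

Fixpoint wf (c : cmd) : bool :=
  match c with
  | Skip => true
  | Const x _ | Read x | Print x => x < 48
  | Plus x y z | Monus x y z => [&& x < 48, y < 48 & z < 48]
  | Get x q y | Put q x y => [&& x < 48, y < 48 & q < 16]
  | Seq c1 c2 => wf c1 && wf c2
  | If x c1 c2 => [&& x < 48, wf c1 & wf c2]
  | Loop x c1 => [&& x < 48, wf c1 & x \notin writes c1]
  end.

(** The factor 16 is obtained by four doublings; the address ends up in register 48. *)
Definition addr_code q y : program :=
  [:: IAdd 48 y y; IAdd 48 48 48; IAdd 48 48 48; IAdd 48 48 48;
      IConst 49 (64 + q); IAdd 48 48 49].

(** Jump targets are absolute, hence the start address [b]. A jump on register 50, which always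
    holds 1, is unconditional. *)
Fixpoint comp (b : nat) (c : cmd) : program :=
  match c with
  | Skip => [::]
  | Const x n => [:: IConst x n]
  | Plus x y z => [:: IAdd x y z]
  | Monus x y z => [:: ISub x y z]
  | Get x q y => addr_code q y ++ [:: ILoad x 48]
  | Put q y x => addr_code q y ++ [:: IStore 48 x]
  | Read x => [:: IRead x]
  | Print x => [:: IPrint x]
  | Seq c1 c2 => let p1 := comp b c1 in p1 ++ comp (b + size p1) c2
  | If x c1 c2 =>
      let p2 := comp b.+1 c2 in
      let bt := b + size p2 + 2 in
      let p1 := comp bt c1 in
      IJumpPos bt x :: p2 ++ IJumpPos (bt + size p1) 50 :: p1
  | Loop x c1 =>
      let p1 := comp (b + 3) c1 in
      [:: IJumpPos (b + 2) x; IJumpPos (b + size p1 + 4) 50; ISub x x 50] ++ p1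
      ++ [:: IJumpPos b 50]
  end.

Definition models (s : store) (X : nat -> nat) : Prop :=
  [/\ forall j, j < 48 -> X j = var s j,
      forall q i, q < 16 -> X (cell q i) = arr s q i & X 50 = 1].

Definition code_at (P : program) b (l : program) :=
  forall k, k < size l -> onth P (b + k) = onth l k.

Lemma onth_cat (T : Type) (l1 l2 : seq T) k :
  onth (l1 ++ l2) k = if k < size l1 then onth l1 k else onth l2 (k - size l1).
Proof. by elim: l1 k => [|x l IH] [|k] //=; rewrite ?subn0 // IH ltnS subSS. Qed.

Lemma code_at_cat P b l1 l2 :
  code_at P b (l1 ++ l2) -> code_at P b l1 /\ code_at P (b + size l1) l2.
Proof.
move=> H; split=> k Hk.
- by rewrite H ?onth_cat ?Hk // size_cat; lia.
- rewrite -addnA H ?size_cat; last by lia.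
  by rewrite onth_cat ltnNge leq_addr /= addKn.
Qed.

Lemma code_at_cons P b i l :
  code_at P b (i :: l) -> onth P b = Some i /\ code_at P b.+1 l.
Proof.
move=> /(@code_at_cat P b [:: i] l)[H1 H2]; split; last by rewrite -addn1.
by have := H1 0; rewrite addn0 => ->.
Qed.

Lemma models_setv s X x a : x < 48 -> models s X -> models (setv s x a) (set_reg X x a).
Proof.
move=> Hx [H1 H2 H3]; split=> [j Hj|q i Hq|] /=; rewrite /set_reg.
- by case: eqP => // _; exact: H1.
- by case: eqP => [|_]; [rewrite /cell; lia | exact: H2].
- by case: eqP => // E; lia.
Qed.

Lemma models_scratch s X x a : (x == 48) || (x == 49) -> models s X -> models s (set_reg X x a).
Proof.
move=> Hx [H1 H2 H3]; split=> [j Hj|q i Hq|] /=; rewrite /set_reg.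
- by case: eqP => // [|_]; [lia | exact: H1].
- by case: eqP => [|_]; [rewrite /cell; lia | exact: H2].
- by case: eqP => // E; lia.
Qed.

Lemma stepE P b X i o ins :
  onth P b = Some ins -> step P (State b X i o) = exec ins (State b X i o).
Proof. by move=> H; rewrite /step /= H. Qed.

Lemma step1 P b X i o ins n :
  onth P b = Some ins ->
  iter n.+1 (step P) (State b X i o) = iter n (step P) (exec ins (State b X i o)).
Proof. by move=> H; rewrite iterSr (stepE _ _ _ H). Qed.

Lemma addr_ok P b q y s X i o :
  y < 48 -> q < 16 -> code_at P b (addr_code q y) -> models s X ->
  exists X', [/\ iter 6 (step P) (State b X i o) = State (b + 6) X' i o, models s X' &
     X' 48 = cell q (var s y)].
Proof.
move=> Hy Hq /code_at_cons[H0 /code_at_cons[H1 /code_at_cons[H2]]].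
move=> /code_at_cons[H3 /code_at_cons[H4 /code_at_cons[H5 _]]] M.
rewrite (step1 _ _ _ _ H0) (step1 _ _ _ _ H1) (step1 _ _ _ _ H2).
rewrite (step1 _ _ _ _ H3) (step1 _ _ _ _ H4) (step1 _ _ _ _ H5).
rewrite {H0 H1 H2 H3 H4 H5} /exec.
have -> : b + 6 = b.+1.+1.+1.+1.+1.+1 by lia.
eexists; split; first by [].
  by do !apply: models_scratch => //.
case: M => E1 _ _; rewrite /set_reg /= E1 // /cell; lia.
Qed.

Lemma frame_var c s x : x \notin writes c -> var (run c s) x = var s x.
Proof.
elim: c s => //= [y n|y y1 y2|y y1 y2|y q y1|y|c1 IH1 c2 IH2|y c1 IH1 c2 IH2|y c1 IH1] s.
1-5: by rewrite inE /set_reg => /negbTE ->.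
- by rewrite mem_cat negb_or => /andP[/IH1 E1 /IH2 E2]; rewrite E2 E1.
- by rewrite mem_cat negb_or => /andP[/IH1 E1 /IH2 E2]; case: ifP.
- rewrite inE negb_or => /andP[/negbTE xy /IH1 E1].
  by elim: (var s y) => //= n IH; rewrite E1 /= /set_reg xy.
Qed.

Lemma frame_arr c s q : q \notin awrites c -> arr (run c s) q = arr s q.
Proof.
elim: c s => //= [q' y z|c1 IH1 c2 IH2|y c1 IH1 c2 IH2|y c1 IH1] s.
- by rewrite inE => /negbTE ->.
- by rewrite mem_cat negb_or => /andP[/IH1 E1 /IH2 E2]; rewrite E2 E1.
- by rewrite mem_cat negb_or => /andP[/IH1 E1 /IH2 E2]; case: ifP.
- by move=> /IH1 E1; elim: (var s y) => //= n IH; rewrite E1.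
Qed.

Lemma frame_io c s : silent c -> sin (run c s) = sin s /\ sout (run c s) = sout s.
Proof.
elim: c s => //= [c1 IH1 c2 IH2|y c1 IH1 c2 IH2|y c1 IH1] s.
- by move=> /andP[/IH1 E1 /IH2 E2]; case: (E2 (run c1 s)) => -> ->.
- by move=> /andP[/IH1 E1 /IH2 E2]; case: ifP.
- move=> /IH1 E1; elim: (var s y) => //= n [IHi IHo].
  by rewrite (proj1 (E1 _)) (proj2 (E1 _)).
Qed.

Lemma comp_ok P c b s X :
  wf c -> code_at P b (comp b c) -> models s X ->
  exists2 X', iter (cost c s) (step P) (State b X (sin s) (sout s)) =
      State (b + size (comp b c)) X' (sin (run c s)) (sout (run c s)) &
    models (run c s) X'.
Proof.
elim: c b s X => /=.
- by move=> b s X _ _ M; exists X => //=; rewrite addn0.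
- move=> x n b s X Hx /code_at_cons[H _] M.
  by exists (set_reg X x n); rewrite ?addn1 /step /= ?H //=; exact: models_setv.
- move=> x y z b s X /and3P[Hx Hy Hz] /code_at_cons[H _] M; exists (set_reg X x (X y + X z)).
    by rewrite addn1 /step /= H.
  by case: (M) => E _ _; rewrite -!E //; exact: models_setv.
- move=> x y z b s X /and3P[Hx Hy Hz] /code_at_cons[H _] M; exists (set_reg X x (X y - X z)).
    by rewrite addn1 /step /= H.
  by case: (M) => E _ _; rewrite -!E //; exact: models_setv.
- move=> x q y b s X /and3P[Hx Hy Hq] /(@code_at_cat P b (addr_code q y) [:: _])[Ha /code_at_cons[H _]] M.
  have [X' [E M' EX]] := addr_ok (sin s) (sout s) Hy Hq Ha M.
  exists (set_reg X' x (X' (X' 48))).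
    by move: E => /= ->; rewrite /step H /= -addnS.
  by rewrite EX; case: (M') => _ -> // _; exact: models_setv.
- move=> q y x b s X /and3P[Hy Hx Hq] /(@code_at_cat P b (addr_code q y) [:: _])[Ha /code_at_cons[H _]] M.
  have [X' [E M' EX]] := addr_ok (sin s) (sout s) Hy Hq Ha M.
  exists (set_reg X' (X' 48) (X' x)).
    by move: E => /= ->; rewrite /step H /= -addnS.
  rewrite EX; case: M' => E1 E2 E3; split=> [j Hj|r i Hr|] /=; rewrite /set_reg.
  + by case: eqP => [|_]; [rewrite /cell; lia | exact: E1].
  + rewrite -(E1 x) //; case: (cell r i =P _) => E4.
      have [-> ->] : r = q /\ i = var s y by move: E4; rewrite /cell; lia.
      by rewrite !eqxx.
    by rewrite E2 //; case: andP => // -[/eqP E5 /eqP E6]; rewrite E5 E6 in E4.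
  + by case: eqP => // ; rewrite /cell; lia.
- move=> x b s X Hx /code_at_cons[H _] M; exists (set_reg X x (head 0 (sin s))).
    by rewrite addn1 /step /= H.
  by have [A B C] := models_setv (head 0 (sin s)) Hx M; split.
- move=> x b s X Hx /code_at_cons[H _] M; exists X; last by case: M => A B C; split.
  by rewrite addn1 /step /= H /=; case: M => E _ _; rewrite E.
- move=> c1 IH1 c2 IH2 b s X /andP[W1 W2] /code_at_cat[H1 H2] M.
  have [X1 E1 M1] := IH1 _ _ _ W1 H1 M.
  have [X2 E2 M2] := IH2 _ _ _ W2 H2 M1.
  by exists X2; rewrite // addnC iterD E1 E2 size_cat addnA.
- move=> x c1 IH1 c2 IH2 b s X /and3P[Hx W1 W2].
  move=> /code_at_cons[H /code_at_cat[H2 /code_at_cons[HJ H1]]] M.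
  case: ifP => Hpos.
    have Eb : (b.+1 + size (comp b.+1 c2)).+1 = b + size (comp b.+1 c2) + 2 by lia.
    rewrite Eb in H1; have [X1 E1 M1] := IH1 _ s _ W1 H1 M.
    exists X1 => //; rewrite (step1 _ _ _ _ H) /=; case: (M) => EM _ _; rewrite EM // Hpos E1.
    by congr State; rewrite /= size_cat /=; lia.
  have [X2 E2 M2] := IH2 _ s _ W2 H2 M.
  exists X2 => //; rewrite (step1 _ _ _ _ H) /=; case: (M) => EM _ _; rewrite EM // Hpos.
  rewrite E2 (stepE _ _ _ HJ) /=; case: M2 => _ _ E50; rewrite E50 /=.
  by congr State; rewrite size_cat /=; lia.
move=> x c1 IH1 b s X /and3P[Hx W1 F].
move=> /code_at_cons[H0 /code_at_cons[H1 /code_at_cons[H2 /code_at_cat[H3 /code_at_cons[H4 _]]]]].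
set body := fun s : store => run c1 (setv s x (var s x).-1).
set bodyc := fun p : store * nat =>
  (run c1 (setv p.1 x (var p.1 x).-1), p.2 + (cost c1 (setv p.1 x (var p.1 x).-1) + 3)).
(* The counter only accumulates, so the cost of the first round can be pulled out in front of the
   remaining ones. *)
have sndE n (p : store * nat) k : (iter n bodyc (p.1, k + p.2)).2 = k + (iter n bodyc p).2.
  elim: n p => [//|n IH] p; rewrite !iterSr -IH.
  by have -> : bodyc (p.1, k + p.2) = ((bodyc p).1, k + (bodyc p).2) by rewrite /bodyc /= -addnA.
set code := comp (b + 3) c1 in H1 H3 H4 *.
have [n En] : exists n, var s x = n by eexists.
rewrite En; elim: n s X En => [|n IH] s X En M; case: (M) => EM _ E50.
  exists X => //=; rewrite (stepE _ _ _ H0) /= EM // En /=.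
  rewrite (stepE _ _ _ H1) /= E50.
  by congr State; rewrite size_cat /=; lia.
set s1 := setv s x n.
have M1 : models s1 (set_reg X x n) by exact: models_setv.
have H3' : code_at P (b + 3) code by rewrite addn3.
have [X2 E2 M2] := IH1 (b + 3) s1 _ W1 H3' M1.
change (sin s1) with (sin s) in E2; change (sout s1) with (sout s) in E2.
have En2 : var (run c1 s1) x = n by rewrite frame_var //= /set_reg eqxx.
have [X3 E3 M3] := IH (run c1 s1) X2 En2 M2.
exists X3; last by rewrite iterSr {2}/body En.
have EB : bodyc (s, 0) = (run c1 s1, cost c1 s1 + 3 + 0) by rewrite /bodyc /= En addn0.
rewrite !iterSr EB (sndE n (run c1 s1, 0)) {2 3}/body En -/s1.
set K := _ + 2 in E3; have -> : cost c1 s1 + 3 + (iter n bodyc (run c1 s1, 0)).2 + 2 =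
  K + (1 + (cost c1 s1 + 2)) by rewrite /K; lia.
rewrite iterD iterD (addn2 (cost c1 s1)) (step1 _ _ _ _ H0) /exec EM // En [0 < n.+1]/=.
rewrite (addn2 b) (step1 _ _ _ _ H2) /exec E50 EM // En subn1 [n.+1.-1]/= -[b.+3]addn3 E2.
rewrite -/code addn3 (step1 _ _ _ _ H4) /exec [iter 0 _ _]/=; case: (M2) => _ _ ->; rewrite [0 < 1]/= E3.
have Eb : body s = run c1 s1 by rewrite /body En.
by rewrite Eb size_cat; congr State; lia.
Qed.

(** Loop rule: the invariant [I] is indexed by the number of completed rounds and [B] bounds the
    cost of one round. The values of everything the body never writes are supplied for each round,
    so [I] has to mention only what changes. *)
Lemma loopP x c s (I : nat -> store -> Prop) B :
  x \notin writes c -> I 0 s ->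
  (forall k s', k < var s x -> I k s' ->
     (forall y, y \notin x :: writes c -> var s' y = var s y) ->
     (forall q, q \notin awrites c -> arr s' q = arr s q) ->
     let s1 := setv s' x (var s x - k.+1) in
     I k.+1 (run c s1) /\ cost c s1 <= B) ->
  I (var s x) (run (Loop x c) s) /\ cost (Loop x c) s <= (B + 3) * var s x + 2.
Proof.
move=> Hx I0 IS; rewrite /= leq_add2r.
set f := fun s' : store => run c (setv s' x (var s' x).-1); set g := fun p : store * nat => _.
suff H k : k <= var s x -> let p := iter k g (s, 0) in
    [/\ p.1 = iter k f s, I k p.1, var p.1 x = var s x - k, p.2 <= (B + 3) * k &
     (forall y, y \notin x :: writes c -> var p.1 y = var s y) /\
     (forall q, q \notin awrites c -> arr p.1 q = arr s q)].
  by have [<- H1 _ H2 _] := H _ (leqnn _).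
elim: k => [|k IH] Hk p; first by split; rewrite ?subn0 ?muln0.
have [E1 Ik Ex Ec [Fv Fa]] := IH (ltnW Hk).
rewrite {}/p iterS; move: (iter k g (s, 0)) E1 Ik Ex Ec Fv Fa => p E1 Ik Ex Ec Fv Fa.
have [] := IS k p.1 Hk Ik Fv Fa; rewrite /g /= Ex subnS => IS1 IS2.
split=> //; first by rewrite -E1 /f Ex.
- by rewrite frame_var //= /set_reg eqxx.
- by rewrite mulnS; lia.
split=> [y Hy|q Hq]; last by rewrite frame_arr //= Fa.
have := Hy; rewrite inE negb_or => /andP[/negbTE Hyx Hyc].
by rewrite frame_var //= /set_reg Hyx Fv.
Qed.

Fixpoint loopfree (c : cmd) : bool :=
  match c with
  | Seq c1 c2 | If _ c1 c2 => loopfree c1 && loopfree c2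
  | Loop _ _ => false
  | _ => true
  end.

Fixpoint maxcost (c : cmd) : nat :=
  match c with
  | Skip => 0
  | Get _ _ _ | Put _ _ _ => 7
  | Seq c1 c2 => maxcost c1 + maxcost c2
  | If _ c1 c2 => maxn (maxcost c1) (maxcost c2) + 2
  | _ => 1
  end.

Lemma cost_loopfree c s : loopfree c -> cost c s <= maxcost c.
Proof.
elim: c s => //= [c1 IH1 c2 IH2|x c1 IH1 c2 IH2] s /andP[H1 H2].
  exact: leq_add (IH1 _ H1) (IH2 _ H2).
by have := IH1 s H1; have := IH2 s H2; case: ifP; lia.
Qed.

(* [repeats c r s t s']: do [c] while [r] is positive leads from [s] to [s'],
   with one more step per round for the jump. *)
Inductive repeats (c : cmd) (r : nat) : store -> nat -> store -> Prop :=
  | repeats_stop s : var (run c s) r = 0 -> repeats c r s (cost c s).+1 (run c s)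
  | repeats_again s t s' : 0 < var (run c s) r -> repeats c r (run c s) t s' ->
      repeats c r s (cost c s + t.+1) s'.

Definition ram_program (ini body : cmd) (r : nat) : program :=
  let p0 := IConst 50 1 :: comp 1 ini in
  let p1 := comp (size p0) body in
  p0 ++ p1 ++ [:: IJumpPos (size p0) r].

Definition store0 (inp : seq nat) := Store (fun=> 0) (fun _ _ => 0) inp [::].

Lemma ram_programP ini body r inp t s :
  wf ini -> wf body -> r < 48 -> repeats body r (run ini (store0 inp)) t s ->
  outputs_within (ram_program ini body r) inp (t + (cost ini (store0 inp)).+1) (sout s).
Proof.
move=> Wi Wb Hr HR; set P := ram_program _ _ _; set b := (size (comp 1 ini)).+1.
have HP : code_at P 0 P by move=> k _; rewrite add0n.
have [H0 /code_at_cat[Hi /code_at_cat[Hb /code_at_cons[Hj _]]]] := code_at_cons HP.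
set s0 := store0 inp.
have M0 : models s0 (set_reg (fun=> 0) 50 1).
  split=> [j Hlt|q i Hq|] //; rewrite /set_reg; case: eqP => //; rewrite ?/cell; lia.
have [X1 E1 M1] := comp_ok Wi Hi M0.
rewrite /outputs_within iterD.
have -> : iter (cost ini s0).+1 (step P) (init inp) =
    State b X1 (sin (run ini s0)) (sout (run ini s0)).
  by rewrite (step1 _ _ _ _ H0) /exec E1 add1n.
suff H s1 X : repeats body r s1 t s -> models s1 X ->
    exists X', iter t (step P) (State b X (sin s1) (sout s1)) =
      State (size P) X' (sin s) (sout s).
  by have [X' ->] := H _ _ HR M1; rewrite /halted /=.
move=> {}HR; elim: HR X => {s1 t s} [s1 E|s1 t s E _ IH] X M.
  have [X2 E2 M2] := comp_ok Wb Hb M.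
  exists X2; rewrite iterS E2 (stepE _ _ _ Hj) /=; case: M2 => E3 _ _.
  rewrite E3 // E /=; congr State; rewrite /P /ram_program /= !size_cat /=; lia.
have [X2 E2 M2] := comp_ok Wb Hb M; have [X3 E3] := IH _ M2.
exists X3; rewrite addnC iterD E2 (step1 _ _ _ _ Hj) /=; case: M2 => E4 _ _.
by rewrite E4 // E /= -E3.
Qed.

(** * Splitting extended And-Or paths *)

Definition bop (a b c : bool) := if a then b && c else b || c.

Definition bigb (x : nat -> bool) (a : bool) (s : seq nat) :=
  if a then all x s else has x s.

(* The values at the empty sequence are chosen neutral for the gate above. *)
Fixpoint chain (x : nat -> bool) (a : bool) (s : seq nat) : bool :=
  if s is i :: s' then bop a (x i) (chain x (~~ a) s') else ~~ a.

(* The extended path with symmetric variables [syms] and the alternating chain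
   [lo, ..., hi - 1], to be realized with delay [dl]; [conj] tells whether the
   outermost gate is an And. *)
Record item := Item {
  conj : bool;
  syms : seq nat;
  lo : nat;
  hi : nat;
  dl : nat
}.

Definition sem (x : nat -> bool) (it : item) :=
  bop (conj it) (bigb x (conj it) (syms it))
    (chain x (~~ conj it) (index_iota (lo it) (hi it))).

Definition odds l k := [seq l + 2 * j | j <- iota 0 k].

Lemma bigb_perm x a s s' : perm_eq s s' -> bigb x a s = bigb x a s'.
Proof. by move=> H; rewrite /bigb (perm_all _ H) (perm_has _ H). Qed.

Lemma bigb_cat x a s s' : bigb x a (s ++ s') = bop a (bigb x a s) (bigb x a s').
Proof. by case: a; rewrite /bigb /bop ?all_cat ?has_cat. Qed.

(** Distributivity, two variables at a time. For [a = true], a variable joined by Or distributes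
    over the conjunction and thus also enters the right part, as a symmetric variable; a variable
    joined by And is needed in the left part only. The empty chain is neutral, which covers
    [k = 0]. *)
Lemma chain_split x a l k h : l + 2 * k < h ->
  chain x (~~ a) (index_iota l h) =
  bop a (chain x (~~ a) (index_iota l (l + 2 * k)))
    (bop (~~ a) (bigb x (~~ a) (odds l k.+1)) (chain x a (index_iota (l + 2 * k).+1 h))).
Proof.
rewrite /index_iota; elim: k l => [|k IH] l Hk.
  rewrite muln0 addn0 subnn [iota l 0]/=.
  have -> : h - l = (h - l.+1).+1 by lia.
  rewrite /odds /= muln0 addn0 negbK /bigb.
  by case: a; rewrite /bop /= ?orbF ?andbT.
have E1 : l + 2 * k.+1 = l.+2 + 2 * k by lia.
have -> : h - l = (h - l.+2).+2 by lia.
have -> : l + 2 * k.+1 - l = (l.+2 + 2 * k - l.+2).+2 by lia.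
rewrite E1 /= negbK IH -?E1 //.
have -> : odds l k.+2 = l :: odds l.+2 k.+1.
  rewrite /odds -[k.+2]/(1 + k.+1) iotaD map_cat (iotaDl 1 0) -map_comp.
  by rewrite [map _ (iota 0 1)]/= muln0 addn0; congr (_ :: _); apply: eq_map => j /=; lia.
move: (chain _ _ (iota l.+2 _)) {IH} => A; move: (chain _ _ _) => B.
rewrite /bigb /bop; case: a => /=; [move: (has _ _) | move: (all _ _)] => b;
  by case: (x l); case: (x l.+1); case: A; case: B; case: b.
Qed.

(** * Weights, loads and the two kinds of splits *)

Section Weights.
Variables (m : nat) (al : nat -> nat).

Definition wt i := 2 ^ al i.
Definition wsum s := \sum_(i <- s) wt i.
Definition wint a b := \sum_(a <= i < b) wt i.

(* At each level every variable of the chain but the last becomes cheaper by twice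
   its weight.  This pays for the variables that become symmetric, and for the
   difference between the charges of the last variable of the left part and of an
   inner one. *)
Definition load (it : item) :=
  wsum (syms it) +
  match hi it - lo it with
  | 0 => 0
  | 1 => wt (lo it)
  | _ => 2 * (dl it).-1 * wint (lo it) (hi it).-1 + 2 * wt (hi it).-1
  end.

Definition heavier i j := al j <= al i.

Definition valid (it : item) :=
  [/\ syms it != [::], sorted heavier (syms it), all (gtn m) (syms it),
      lo it <= hi it <= m & load it <= 2 ^ dl it].

(* Each of the remaining levels visits every symmetric variable at most once, and
   every variable of the chain once for each copy made so far. *)
Definition pot (it : item) := (dl it).+1 * (size (syms it) + (dl it).+1 * (hi it - lo it)).

(** By the last clause the released potential is at least the number of variables of the item; up to
    the factor [unit_cost] this pays for the split. *)
Definition splits (it c1 c2 : item) :=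
  [/\ valid c1, valid c2, dl it = (dl c1).+1 /\ dl it = (dl c2).+1,
      forall x, sem x it = bop (conj it) (sem x c1) (sem x c2) &
      pot c1 + pot c2 + (size (syms it) + (hi it - lo it)) <= pot it].

Lemma wt_gt0 i : 0 < wt i. Proof. by rewrite expn_gt0. Qed.

Lemma wsum_cat s t : wsum (s ++ t) = wsum s + wsum t.
Proof. exact: big_cat. Qed.

Lemma size_wsum s : size s <= wsum s.
Proof.
rewrite /wsum; elim: s => [|i s IH]; rewrite ?big_nil ?big_cons //=.
by have := wt_gt0 i; lia.
Qed.

Lemma wint_recr a b : a <= b -> wint a b.+1 = wint a b + wt b.
Proof. by move=> H; rewrite /wint big_nat_recr. Qed.

Lemma wint_cat a b c : a <= b -> b <= c -> wint a c = wint a b + wint b c.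
Proof. by move=> H1 H2; rewrite /wint (big_cat_nat H1 H2). Qed.

Lemma wsum_odds l k : wsum (odds l k.+1) <= wint l (l + 2 * k).+1.
Proof.
elim: k => [|k IH].
  by rewrite /wsum /odds /= big_seq1 muln0 addn0 wint_recr // leq_addl.
have -> : odds l k.+2 = odds l k.+1 ++ [:: l + 2 * k.+1].
  by rewrite /odds -[k.+2]addn1 iotaD map_cat.
rewrite wsum_cat {2}/wsum big_seq1 (_ : (l + 2 * k.+1).+1 = (l + 2 * k).+3); last by lia.
rewrite wint_recr; last by lia.
rewrite wint_recr; last by lia.
have -> : (l + 2 * k).+2 = l + 2 * k.+1 by lia.
by lia.
Qed.

Lemma load_mono it d : dl it <= d -> load it <= load (Item (conj it) (syms it) (lo it) (hi it) d).
Proof.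
move=> H; rewrite /load /= leq_add2l; case: (hi it - lo it) => [|[|n]] //.
by rewrite leq_add2r leq_mul2r leq_mul2l; apply/orP; right; lia.
Qed.

Lemma dvdn_wsum e s : all (fun i => e <= al i) s -> 2 ^ e %| wsum s.
Proof.
rewrite /wsum; elim: s => [|i s IH] /=; rewrite ?big_nil ?big_cons ?dvdn0 //.
by move=> /andP[H1 H2]; rewrite dvdn_add ?IH // dvdn_exp2l.
Qed.

Lemma heavier_trans : transitive heavier.
Proof. by move=> i j k H1 H2; exact: leq_trans H2 H1. Qed.

(* All summands of the prefix and the bound itself are multiples of the weight
   of the next element, so the prefix cannot stop strictly below the bound. *)
Lemma greedy_exact s j D : sorted heavier s -> j < size s ->
  all (fun i => al i <= D) s -> wsum (take j s) <= 2 ^ D ->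
  2 ^ D < wsum (take j s) + wt (nth 0 s j) -> wsum (take j s) = 2 ^ D.
Proof.
move=> Hs Hj HD H1 H2; set v := nth 0 s j in H2.
have Hv : al v <= D by apply: (allP HD); exact: mem_nth.
have dv1 : 2 ^ al v %| wsum (take j s).
  apply: dvdn_wsum; apply/(all_nthP 0) => i; rewrite size_takel ?(ltnW Hj) // => Hi.
  rewrite nth_take //.
  by have := sorted_ltn_nth heavier_trans 0 Hs; apply; rewrite ?inE //; lia.
have dv2 : 2 ^ al v %| 2 ^ D by rewrite dvdn_exp2l.
move: H1 H2; rewrite /wt; move: dv1 dv2 => /dvdnP[a ->] /dvdnP[b ->].
set c := 2 ^ al v; rewrite addnC -mulSn.
have c0 : 0 < c by rewrite expn_gt0.
rewrite leq_pmul2r // ltn_pmul2r // => H1 H2.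
by congr (_ * _); lia.
Qed.

(** A second variable has positive weight, so a single symmetric one weighs strictly less than
    [2^d]; being a power of two, it weighs at most [2^(d-1)]. Hence a greedy prefix of budget
    [2^(d-1)] is never empty. *)
Lemma valid_big it : valid it -> 1 < size (syms it) + (hi it - lo it) ->
  0 < dl it /\ all (fun i => al i <= (dl it).-1) (syms it).
Proof.
case: it => a s l h d [/= V1 V2 V3 V4 V5] /= H.
have s0 : 0 < size s by rewrite lt0n size_eq0.
have Hlt i : i \in s -> wt i < 2 ^ d.
  move=> Hi; apply: leq_trans V5; rewrite /load /= /wsum (big_rem i) //=.
  rewrite -addnA -[X in X < _]addn0 ltn_add2l; have [N0|N0] := posnP (h - l).
    apply: leq_trans (leq_addr _ _) => /=; apply: leq_trans (size_wsum (rem i s)).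
    by rewrite size_rem // -ltnS prednK ?size_gt0 //; rewrite N0 addn0 in H.
  apply: leq_trans (leq_addl _ _); case: (h - l) N0 => [|[|n]] // _; first exact: wt_gt0.
  by rewrite addn_gt0 [0 < 2 * wt _]muln_gt0 wt_gt0 orbT.
have d0 : 0 < d.
  case: s s0 Hlt {V1 V2 V3 V5 H} => // i s _ /(_ i); rewrite mem_head => /(_ isT).
  by have := wt_gt0 i; case: d => //; rewrite expn0; lia.
split=> //; apply/allP => i /Hlt; rewrite /wt ltn_exp2l //; lia.
Qed.

(** A prefix of weight exactly [2^(d-1)] takes away half of the budget, and the charge of the chain
    does not grow when [d] drops, so the rest fits into the other half. Without a chain it suffices
    that both sums fit. *)
Lemma splitS it j : valid it -> 0 < dl it -> 0 < j < size (syms it) ->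
  wsum (take j (syms it)) <= 2 ^ (dl it).-1 ->
  wsum (take j (syms it)) = 2 ^ (dl it).-1 \/
  hi it = lo it /\ wsum (drop j (syms it)) <= 2 ^ (dl it).-1 ->
  splits it (Item (conj it) (take j (syms it)) 0 0 (dl it).-1)
    (Item (conj it) (drop j (syms it)) (lo it) (hi it) (dl it).-1).
Proof.
case: it => a s l h [//|d] [/= V1 V2 V3 V4 V5] _ /andP[Hj0 Hj1] Hw Hd.
have := cat_take_drop j s; set s1 := take j s in Hw Hd *; set s2 := drop j s in Hd * => Es.
have sz1 : size s1 = j by rewrite size_takel // ltnW.
have sz2 : size s2 = size s - j by rewrite size_drop.
split; rewrite /valid /=.
- split; rewrite -?size_eq0 ?sz1 -?lt0n //; first exact: take_sorted.
    by move: V3; rewrite -{1}Es all_cat => /andP[].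
  by rewrite /load /= addn0.
- split; rewrite -?size_eq0 ?sz2 -?lt0n ?subn_gt0 //; first exact: drop_sorted.
    by move: V3; rewrite -{1}Es all_cat => /andP[].
  have [E|[E1 E2]] := Hd; last by rewrite /load /= E1 subnn addn0.
  have := leq_trans (@load_mono (Item a s l h d) d.+1 (leqnSn _)) V5.
  have Ew : wsum s = 2 ^ d + wsum s2 by rewrite -E -wsum_cat Es.
  have E2 : 2 ^ d.+1 = 2 ^ d + 2 ^ d by rewrite expnS; lia.
  by rewrite /load /= Ew E2 -addnA leq_add2l.
- by [].
- move=> x; rewrite /sem /= negbK.
  have -> : bigb x a s = bop a (bigb x a s1) (bigb x a s2) by rewrite -bigb_cat Es.
  by move: (bigb _ _ _) (bigb _ _ _) (chain _ _ _); case: (a) => - [] [] [].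
- rewrite /pot /= sz1 sz2; move: (h - l) => N.
  have -> : d.+1 * (j + d.+1 * 0) + d.+1 * (size s - j + d.+1 * N) = d.+1 * (size s + d.+1 * N).
    by rewrite muln0 addn0 -mulnDr addnA subnKC // ltnW.
  by rewrite !mulnDr !mulSn; lia.
Qed.

(** The load bound for a left part with chain [lo, ..., p - 1] of at least two variables. That part
    has delay [dl - 1], whence the double predecessor. *)
Definition fits (it : item) p :=
  wsum (syms it) + 2 * (dl it).-2 * wint (lo it) p.-1 + 2 * wt p.-1 <= 2 ^ (dl it).-1.

(** The left part is valid by its own test, or for [k = 0] because its chain is empty. The right
    part is valid because [k] cannot be increased: either the chain is nearly exhausted or the test
    fails at [p + 2]. *)
Lemma splitT it k (s : seq nat) (p := lo it + 2 * k) : valid it -> 0 < dl it -> p < hi it ->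
  wsum (syms it) <= 2 ^ (dl it).-1 ->
  k = 0 \/ fits it p -> hi it <= p.+2 \/ ~~ fits it p.+2 ->
  perm_eq s (odds (lo it) k.+1) -> sorted heavier s ->
  splits it (Item (conj it) (syms it) (lo it) p (dl it).-1)
    (Item (~~ conj it) s p.+1 (hi it) (dl it).-1).
Proof.
case: it @p => a s0 l h [//|d] /= [/= V1 V2 V3 /andP[V4 V4'] V5] _ Hp Hw Hk Hst Hperm Hs.
set p := l + 2 * k in Hp Hk Hst *.
have szs : size s = k.+1 by rewrite (perm_size Hperm) size_map size_iota.
have ws : wsum s <= wint l p.+1 by rewrite /wsum (perm_big _ Hperm) /=; exact: wsum_odds.
have ws0 : 0 < wsum s0 by apply: leq_trans (size_wsum s0); rewrite lt0n size_eq0.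
have lp : l <= p by exact: leq_addr.
have Eh : wint l h = wint l h.-1 + wt h.-1.
  by rewrite -wint_recr ?prednK //; lia.
split; rewrite /valid /=.
- split=> //; first by rewrite lp /=; lia.
  rewrite /load /=; have [k0|kn] := eqVneq k 0.
    by rewrite /p k0 muln0 addn0 subnn addn0.
  have -> : p - l = (p - l).-2.+2 by rewrite /p; lia.
  by case: Hk => [k0|]; [rewrite k0 in kn | rewrite /fits /= addnA].
- split=> //; first by rewrite -size_eq0 szs.
    rewrite (perm_all _ Hperm); apply/allP => i /mapP[j]; rewrite mem_iota => Hj -> /=.
    by move: Hp; rewrite /p; lia.
    by apply/andP.
  (* At most one chain variable remains on the right, so there each variable counts at most once. If
     the old chain has at least two variables, its load counts each of them at least twice; if it
     has one, that variable weighs strictly less than the budget, hence at most half of it. *)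
  have [hE|hN] := leqP h p.+2.
    have Hws : wsum s + wint p.+1 h <= wint l h.
      by rewrite (@wint_cat l p.+1 h) // ?leq_add2r // ltnW.
    have -> : load (Item (~~ a) s p.+1 h d) = wsum s + wint p.+1 h.
      rewrite /load /=; congr (_ + _).
      have [->|->] : h = p.+1 \/ h = p.+2 by lia.
        by rewrite subnn /wint big_geq.
      by rewrite subSnn /wint big_nat1.
    apply: leq_trans Hws _; move: V5; rewrite /load /= Eh {Hst}.
    case Eq: (h - l) => [|[|n]]; first by lia.
      have -> : h.-1 = l by lia.
      rewrite /wint big_geq // add0n => V5.
      by rewrite leq_exp2l // -ltnS -(@ltn_exp2l 2) //; apply: leq_trans V5; rewrite -/(wt l); lia.
    rewrite expnS; case: d {Hw Hk} => [|d] V5; last by move: V5; rewrite -mulnA mulSn; lia.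
    by have := wt_gt0 h.-1; lia.
  case: Hst => [|]; first by lia.
  (* Subtracting the failed test from the load of the whole leaves less than [2^d]. What remains
     contains [2 w(l ... p)], enough for the new symmetric variables. The failed test charges
     [2 w(p+1)] for its last variable; this is covered because [p + 1] is an inner variable of the
     right chain and its charge drops by as much. *)
  rewrite /fits /= -ltnNge => Hst; move: V5; rewrite /load /=.
  have -> : h - l = (h - l).-2.+2 by lia.
  have -> : h - p.+1 = (h - p.+1).-2.+2 by lia.
  have E1 : wint l h.-1 = wint l p.+1 + wint p.+1 h.-1 by apply: wint_cat; lia.
  have E2 : wint p.+1 h.-1 = wt p.+1 + wint p.+2 h.-1.
    rewrite (@wint_cat p.+1 p.+2); [|lia|lia]; congr (_ + _).
    by rewrite /wint big_nat1.
  rewrite expnS E1 E2; case: d Hst {Hw Hk} => [|d] /=; first by have := wt_gt0 h.-1; lia.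
  by rewrite !mulnDr !mulnS !mulnDl; lia.
- by [].
- move=> x; rewrite /sem /= (@chain_split x a l k h) // (bigb_perm _ _ Hperm) negbK.
  by move: (bigb _ _ _) (bigb _ _ _) (chain _ _ _) (chain _ _ _); case: (a) => - [] [] [] [].
(* The variable [p] leaves both chains. The [k + 1] new symmetric variables stem from the old chain,
   whose charge drops by one per variable inside the outer factor; this pays for them. *)
- rewrite /pot /= szs; have : k.+1 <= h - l by move: Hp; rewrite /p; lia.
  have : p - l + (h - p.+1) = (h - l).-1 by lia.
  move: (p - l) (h - p.+1) => u v; move: (h - l) (size s0) => N z Euv HN.
  have -> : d.+1 * (z + d.+1 * u) + d.+1 * (k.+1 + d.+1 * v) + (z + N) =
      d.+1 * (z + k.+1 + d.+1 * (u + v)) + (z + N) by rewrite !mulnDr; lia.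
  have -> : d.+2 * (z + d.+2 * N) = d.+1 * (z + N + d.+1 * N) + (z + d.+2 * N).
    by nia.
  by rewrite leq_add ?leq_mul ?leq_add ?leq_mul ?leq_pmull // Euv; lia.
Qed.

End Weights.

(** * Circuits from formula trees *)

Definition item0 := Item true [::] 0 0 0.

Section Circuit.
Variables (m : nat) (al : nat -> nat) (its : seq item) (ch : seq (option nat)).

Let it i := nth item0 its i.

(* [nth None ch i = Some c] means that the children of item i are the items c
   and c + 1; item i becomes node i + 1 of the circuit, node 0 is the output. *)
Definition node_ok i :=
  match nth None ch i with
  | None => exists2 v, syms (it i) = [:: v] & [/\ v < m, lo (it i) = hi (it i) & al v <= dl (it i)]
  | Some c => [/\ i < c, c.+1 < size its & splits m al (it i) (it c) (it c.+1)]
  end.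

Definition has_parent j := exists2 i, i < j & nth None ch i = Some j \/ nth None ch i = Some j.-1.

Definition encode_item i :=
  match nth None ch i with
  | None => [:: 0; head 0 (syms (it i))]
  | Some c => [:: if conj (it i) then 1 else 2; c.+1; c.+2]
  end.

Hypothesis m0 : 0 < m.
Hypothesis its0 : 0 < size its.
Hypothesis nodes : forall i, i < size its -> node_ok i.
Hypothesis parents : forall j, 0 < j < size its -> has_parent j.

Let i0 : 'I_m := Ordinal m0.
Let N := size its.

Definition tree_label (v : 'I_N.+1) : label m :=
  if val v is i.+1 then
    match nth None ch i with
    | None => Input (insubd i0 (head 0 (syms (it i))))
    | Some _ => if conj (it i) then And else Or
    end
  else Output.

Definition tree_arc (u v : 'I_N.+1) :=
  if val v is i.+1 then
    if nth None ch i is Some c then (val u == c.+1) || (val u == c.+2) else false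
  else val u == 1.

Definition tree_circuit : digraph m := Digraph tree_label tree_arc.

(** Children are created after their parents, so arcs, which lead from a child to its parent,
    decrease the node number. Acyclicity follows. *)
Lemma tree_arc_lt u v : tree_arc u v -> v < u.
Proof.
case: v => -[|i] Hi; rewrite /tree_arc /=; first by move/eqP=> ->.
have := nodes Hi; rewrite /node_ok; case: (nth None ch i) => // c [H _ _].
by case/orP => /eqP ->; lia.
Qed.

Lemma tree_acyclic : acyclic tree_circuit.
Proof.
move=> u v /tree_arc_lt uv; apply/negP => /connectP[p Hp Ep].
have : last v p <= v.
  elim: p v Hp {uv Ep} => //= w p IH v /andP[/tree_arc_lt H /IH] H2; exact: leq_trans H2 (ltnW H).
by rewrite -Ep leqNgt uv.
Qed.

Lemma tree_indegree v : @indegree m tree_circuit v = label_indegree (tree_label v).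
Proof.
rewrite /indegree /=; case: v => -[|i] Hi.
  rewrite /tree_label /= -(card1 (inord 1 : 'I_N.+1)); apply: eq_card => u.
  by rewrite !inE /tree_arc /= -val_eqE /= inordK // ltnS.
have := nodes Hi; rewrite /node_ok /tree_label /tree_arc /=.
case: (nth None ch i) => [c [H1 H2 _]|[w _ _]]; last first.
  by rewrite eq_card0.
have -> : label_indegree (if conj (it i) then And else @Or m) = 2 by case: conj.
have K1 : (inord c.+1 : 'I_N.+1) = c.+1 :> nat by rewrite inordK // /N; lia.
have K2 : (inord c.+2 : 'I_N.+1) = c.+2 :> nat by rewrite inordK // /N; lia.
transitivity #|pred2 (inord c.+1 : 'I_N.+1) (inord c.+2)|.
  by apply: eq_card => u; rewrite !inE -!val_eqE /= K1 K2.
by rewrite card2 -val_eqE /= K1 K2; lia.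
Qed.

Lemma tree_outdegree (v : 'I_N.+1) : (@outdegree m tree_circuit v == 0) = (val v == 0).
Proof.
rewrite /outdegree /=; case: v => -[|j] Hj /=.
  rewrite eqxx; apply/eqP/eq_card0 => u; rewrite !inE; apply/negP => /tree_arc_lt /=; lia.
apply/negbTE; rewrite -lt0n; apply/card_gt0P; case: j Hj => [|j] Hj.
  by exists ord0; rewrite inE /tree_arc.
have [i Hi E] := parents (Hj : 0 < j.+1 < size its).
have Hi' : i.+1 < N.+1 by rewrite /N; lia.
exists (Ordinal Hi'); rewrite inE /tree_arc /=.
by case: E => -> /=; rewrite eqxx ?orbT.
Qed.

Lemma tree_is_circuit : is_circuit tree_circuit.
Proof.
split; first exact: tree_acyclic.
- exact: tree_indegree.
- move=> v; rewrite tree_outdegree /=; case: v => -[|i] Hi //=; rewrite /tree_label /=.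
  by case: (nth _ _ _) => //= c; case: conj.
- rewrite -(card1 (ord0 : 'I_N.+1)); apply: eq_card => v.
  by rewrite !inE tree_outdegree -val_eqE.
Qed.

Lemma tree_encodes :
  encodes ([:: 3; 1] ++ flatten [seq encode_item i | i <- iota 0 N]) tree_circuit.
Proof.
exists (fun v : 'I_N.+1 => if val v is i.+1 then
    if nth None ch i is Some c then [:: inord c.+1; inord c.+2] else [::]
  else [:: inord 1]) => [v|] /=.
  case: v => -[|i] Hi /=.
    split=> // u; rewrite !inE /tree_arc /= -val_eqE /= inordK // ltnS //.
  have := nodes Hi; rewrite /node_ok /tree_arc /=.
  case: (nth None ch i) => [c [H1 H2 _]|[w _ _]]; last by split.
  have K1 : (inord c.+1 : 'I_N.+1) = c.+1 :> nat by rewrite inordK // /N; lia.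
  have K2 : (inord c.+2 : 'I_N.+1) = c.+2 :> nat by rewrite inordK // /N; lia.
  split=> [|u]; first by rewrite /= inE -val_eqE /= K1 K2; lia.
  by rewrite !inE -!val_eqE /= K1 K2.
rewrite enum_ordSl /= inordK ?ltnS //; congr [:: _, _ & _].
rewrite -map_comp; congr flatten; rewrite -val_enum_ord -map_comp; apply: eq_map => i /=.
have Hi := ltn_ord i; rewrite /tree_label /encode_item /=; have := nodes Hi; rewrite /node_ok.
case: (nth None ch i) => [c [H1 H2 _]|[w -> [Hw _ _]]]; last first.
  by rewrite /= val_insubd Hw.
by rewrite /= !inordK /N; try lia; case: conj.
Qed.

Lemma tree_realizes (f : ('I_m -> bool) -> bool) :
  (forall x, sem (fun i => x (insubd i0 i)) (it 0) = f x) -> realizes tree_circuit f.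
Proof.
move=> Hf x; set xn := fun i => x (insubd i0 i).
exists (fun v : 'I_N.+1 => if val v is i.+1 then sem xn (it i) else sem xn (it 0)); last first.
  case=> -[|i] Hi /=; rewrite /tree_label /=; first by rewrite Hf.
  by case: nth => [c|] //; case: conj.
case=> -[|i] Hi; rewrite /= /tree_label /=.
  by move=> u; rewrite /tree_arc /= => /eqP ->.
have := nodes Hi; rewrite /node_ok /tree_arc /=.
case: (nth None ch i) => [c [H1 H2 [_ _ _ -> _]]|[w E1 [Hw E2 _]]]; last first.
  by rewrite /sem E1 E2 /index_iota subnn /= /bop /bigb /=; case: conj; rewrite /= ?andbT ?orbF.
have K1 : (inord c.+1 : 'I_N.+1) = c.+1 :> nat by rewrite inordK // /N; lia.
have K2 : (inord c.+2 : 'I_N.+1) = c.+2 :> nat by rewrite inordK // /N; lia.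
case: conj; rewrite /bop.
  apply/andP/forall_inP => [[S1 S2] u /orP[] /eqP -> //|H]; split.
    by have := H (inord c.+1); rewrite K1 eqxx; apply.
  by have := H (inord c.+2); rewrite K2 eqxx orbT; apply.
apply/orP/exists_inP => [[S1|S2]|[u /orP[] /eqP -> S]].
- by exists (inord c.+1); rewrite K1 ?eqxx.
- by exists (inord c.+2); rewrite K2 ?eqxx ?orbT.
- by left.
- by right.
Qed.

(** The value [dl] drops by exactly one from a gate to its children, so a path starting at a leaf of
    delay [dl] meets at most [D - dl] gates, and the shifted arrival time of the leaf is at most
    [dl]. *)
Lemma tree_delay (a : 'I_m -> nat) B :
  (forall i, a i + dl (it 0) <= B + al i) -> delay a tree_circuit <= B.
Proof.
move=> Ha; set D := dl (it 0) in Ha.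
have dlD j : j < N -> dl (it j) <= D.
  elim/ltn_ind: j => -[|j] IH Hj //; have [i Hi E] := parents (Hj : 0 < j.+1 < size its).
  have Hi' : i < size its by apply: ltn_trans Hi Hj.
  have := nodes Hi'; rewrite /node_ok; have := IH i Hi Hi'.
  by case: E => /= -> Hd [_ _ [_ _ [E1 E2] _ _]]; lia.
pose gates (s : seq 'I_N.+1) := count (fun u => is_gate (tree_label u)) s.
have Hg0 (v : 'I_N.+1) p : path tree_arc v p -> val v = 0 -> gates (v :: p) = 0.
  move=> Hp Ev; have {}Ev : v = ord0 by exact: val_inj.
  by rewrite {}Ev in Hp *; case: p Hp => //= u p /andP[/tree_arc_lt].
(* The difference [D - dl] accounts for the proper ancestors of [v]; the summand [is_gate] is for
   [v] itself. *)
have Hg p (v : 'I_N.+1) i : path tree_arc v p -> val v = i.+1 ->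
    gates (v :: p) + dl (it i) <= D + is_gate (tree_label v).
  elim: p v i => [|u p IH] v i /=.
    by move=> _ E; have := ltn_ord v; rewrite E ltnS => /dlD; rewrite /gates /=; lia.
  move=> /andP[Hvu Hp] E; case Eu: (val u) => [|j].
    have := ltn_ord v; rewrite E ltnS => /dlD; have := Hg0 _ _ Hp Eu; rewrite /gates /=; lia.
  have := IH _ _ Hp Eu; move: Hvu; rewrite /tree_arc Eu.
  have Hj : j < size its by have := ltn_ord u; rewrite [nat_of_ord u]Eu ltnS.
  have := nodes Hj; rewrite /node_ok; case: (nth None ch j) => // c [_ _ [_ _ [E1 E2] _ _]].
  have : is_gate (tree_label u) <= 1 by case: is_gate.
  rewrite ?[nat_of_ord v]E ?[val v]E !eqSS /gates /= => H1 /orP[] /eqP ->; lia.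
apply/bigmax_leqP => v Hv; rewrite /node_delay.
case: v Hv => -[|i] Hi Hv; first by [].
have := nodes (Hi : i < size its); move: Hv; rewrite /= {1 2}/tree_label /= /node_ok.
case Ec: (nth None ch i) => [c|] /=; first by case: conj.
move=> _ [w E1 [Hw _ Hal]]; rewrite E1 /=; set g := max_gates_from _.
have : g + dl (it i) <= D.
  rewrite addnC -leq_subRL; last exact: dlD.
  apply/bigmax_leqP => p Hp; have := Hg _ _ i Hp erefl.
  rewrite /gates /= /tree_label /= Ec /=; lia.
have := Ha (insubd i0 w); rewrite val_insubd Hw; lia.
Qed.

End Circuit.

(** * The program building the tree *)

Notation v_m := 0 (only parsing).
Notation v_one := 1 (only parsing).
Notation v_max := 2 (only parsing).
Notation v_L := 3 (only parsing).
Notation v_i := 4 (only parsing).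
Notation v_cnt := 5 (only parsing).
Notation v_t := 6 (only parsing).
Notation v_t2 := 7 (only parsing).
Notation v_t3 := 8 (only parsing).
Notation v_pow := 9 (only parsing).
Notation v_tot := 10 (only parsing).
Notation v_w0 := 11 (only parsing).
Notation v_wl := 12 (only parsing).
Notation v_d := 13 (only parsing).
Notation v_e := 14 (only parsing).
Notation v_f := 15 (only parsing).
Notation v_sl := 16 (only parsing).
Notation v_sh := 17 (only parsing).
Notation v_tl := 18 (only parsing).
Notation v_th := 19 (only parsing).
Notation v_N := 20 (only parsing).
Notation v_ls := 21 (only parsing).
Notation v_d1 := 22 (only parsing).
Notation v_pw := 23 (only parsing).
Notation v_acc := 24 (only parsing).
Notation v_j := 25 (only parsing).
Notation v_x := 26 (only parsing).
Notation v_y := 27 (only parsing).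
Notation v_X := 28 (only parsing).
Notation v_p := 29 (only parsing).
Notation v_k := 30 (only parsing).
Notation v_sp := 31 (only parsing).
Notation v_sp0 := 32 (only parsing).
Notation v_h := 33 (only parsing).
Notation v_tail := 34 (only parsing).
Notation v_r := 35 (only parsing).
Notation v_c1 := 36 (only parsing).
Notation v_c2 := 37 (only parsing).
Notation v_zero := 38 (only parsing).
Notation v_three := 39 (only parsing).
Notation v_g := 40 (only parsing).
Notation v_X2 := 41 (only parsing).
Notation v_p1 := 42 (only parsing).
Notation v_z := 43 (only parsing).
Notation v_mc := 44 (only parsing).

Notation a_al := 0 (only parsing).
Notation a_wt := 1 (only parsing).
Notation a_pow := 2 (only parsing).
Notation a_S := 3 (only parsing).
Notation a_f := 4 (only parsing).
Notation a_sl := 5 (only parsing).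
Notation a_sh := 6 (only parsing).
Notation a_tl := 7 (only parsing).
Notation a_th := 8 (only parsing).
Notation a_d := 9 (only parsing).

Infix ";;" := Seq (at level 60, right associativity).

(** The cost is linear in the factor [y], so callers pass the small factor there. It is copied
    because a loop consumes its counter. *)
Definition c_mul x y z := Const x 0 ;; Plus v_mc y v_zero ;; Loop v_mc (Plus x x z).

Definition c_load :=
  Get v_f a_f v_h ;; Get v_sl a_sl v_h ;; Get v_sh a_sh v_h ;;
  Get v_tl a_tl v_h ;; Get v_th a_th v_h ;; Get v_d a_d v_h ;;
  Monus v_N v_th v_tl ;; Monus v_ls v_sh v_sl ;; Plus v_t v_N v_ls ;; Monus v_t v_t v_one ;;
  Monus v_d1 v_d v_one ;; Get v_pw a_pow v_d1.

Definition c_leaf := Print v_zero ;; Get v_x a_S v_sl ;; Print v_x.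

(* After the first failure [v_j] no longer moves, so the test keeps failing; the
   same holds for [c_tscan]. *)
Definition c_scan :=
  Const v_acc 0 ;; Plus v_j v_sl v_zero ;; Plus v_cnt v_ls v_zero ;;
  Loop v_cnt (Get v_x a_S v_j ;; Get v_y a_wt v_x ;; Plus v_y v_acc v_y ;;
    Monus v_t v_y v_pw ;;
    If v_t Skip (Plus v_acc v_y v_zero ;; Plus v_j v_j v_one)).

(** If the scan has consumed all symmetric variables and there is no chain, the cut moves back by
    one, so that the second part is nonempty. The gate is printed with its two children, which will
    occupy the next free slots. Finally [v_t] is positive exactly if symmetric variables are to be
    split. *)
Definition c_adjust :=
  Monus v_t v_sh v_j ;; Plus v_t v_t v_N ;; If v_t Skip (Monus v_j v_j v_one) ;;
  Plus v_t2 v_tail v_one ;; Print v_f ;; Print v_tail ;; Print v_t2 ;;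
  Monus v_t v_sh v_j.

Definition c_put idx f sl sh tl th :=
  Put a_f idx f ;; Put a_sl idx sl ;; Put a_sh idx sh ;;
  Put a_tl idx tl ;; Put a_th idx th ;; Put a_d idx v_d1.

Definition c_splitS :=
  c_put v_tail v_f v_sl v_j v_zero v_zero ;; c_put v_t2 v_f v_j v_sh v_tl v_th.

Definition c_tscan0 :=
  Monus v_e v_d1 v_one ;; Plus v_e v_e v_e ;; Const v_X 0 ;; Plus v_p v_tl v_zero ;;
  Const v_k 1 ;; Plus v_cnt v_N v_zero.

Definition c_tscan1 :=
  Plus v_p1 v_p v_one ;; Plus v_t v_p1 v_one ;; Monus v_t v_th v_t.

Definition c_tscan2 := Get v_y a_wt v_p ;; Plus v_X2 v_X v_y.

Definition c_tscan3 :=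
  Plus v_t v_t v_acc ;; Get v_z a_wt v_p1 ;; Plus v_t v_t v_z ;; Plus v_t v_t v_z ;;
  Monus v_t v_t v_pw ;;
  If v_t Skip (Plus v_X v_X2 v_z ;; Plus v_p v_p1 v_one ;; Plus v_k v_k v_one).

Definition c_tscan :=
  c_tscan0 ;;
  Loop v_cnt (c_tscan1 ;; If v_t (c_tscan2 ;; c_mul v_t v_e v_X2 ;; c_tscan3) Skip).

(* Bucket sort: the counter [v_c1] of the outer loop runs through the possible
   arrival times from [L] down to 0. *)
Definition c_select :=
  Get v_t a_al v_x ;; Monus v_t2 v_t v_c1 ;; Monus v_t3 v_c1 v_t ;; Plus v_t2 v_t2 v_t3 ;;
  If v_t2 Skip (Put a_S v_sp v_x ;; Plus v_sp v_sp v_one) ;;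
  Plus v_x v_x v_one ;; Plus v_x v_x v_one.

Definition c_select0 := Plus v_x v_tl v_zero ;; Plus v_c2 v_k v_zero.

Definition c_filter0 := Plus v_sp0 v_sp v_zero ;; Plus v_c1 v_L v_one.

Definition c_filter :=
  c_filter0 ;; Loop v_c1 (c_select0 ;; Loop v_c2 c_select).

(** The gate codes are 1 and 2, so [3 - f] is the code of the dual gate. *)
Definition c_splitT0 :=
  Plus v_t2 v_tail v_one ;; Monus v_g v_three v_f ;; Plus v_p1 v_p v_one.

Definition c_splitT :=
  c_tscan ;; c_filter ;; c_splitT0 ;;
  c_put v_tail v_f v_sl v_sh v_tl v_p ;; c_put v_t2 v_g v_sp0 v_sp v_p1 v_th.

Definition c_inner := c_scan ;; c_adjust ;; If v_t c_splitS c_splitT.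

Definition c_grow := Plus v_tail v_tail v_one ;; Plus v_tail v_tail v_one.

Definition c_next := Plus v_h v_h v_one ;; Monus v_r v_tail v_h.

Definition c_body := c_load ;; If v_t (c_inner ;; c_grow) c_leaf ;; c_next.

Lemma c_mulP x y z s : x \notin [:: y; z; v_mc; v_zero] -> z != v_mc -> y != v_mc ->
  z != v_zero -> var s v_zero = 0 ->
  var (run (c_mul x y z) s) x = var s y * var s z /\
  cost (c_mul x y z) s <= 4 * var s y + 4.
Proof.
rewrite !inE !negb_or => /and4P[xy xz xm x0] zm ym z0 H0.
rewrite /c_mul; set s1 := run (Const x 0 ;; Plus v_mc y v_zero) s.
have E1 : var s1 v_mc = var s y.
  by rewrite /s1 /= /set_reg /= ![_ == x]eq_sym (negbTE xy) (negbTE x0) H0 addn0.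
have E2 : var s1 z = var s z.
  by rewrite /s1 /= /set_reg (negbTE zm) eq_sym (negbTE xz).
have E3 : var s1 x = 0 by rewrite /s1 /= /set_reg (negbTE xm) eqxx.
have [] := @loopP v_mc (Plus x x z) s1 (fun k s' => var s' x = k * var s z) 1.
- by rewrite inE eq_sym.
- by [].
- move=> k s' Hk Ik Fv _ /=; split=> //.
  rewrite /set_reg eqxx (negbTE xm) (negbTE zm) Ik Fv ?E2 ?mulSn 1?addnC //.
  by rewrite !inE negb_or zm eq_sym xz.
rewrite E1 => I1 C1; split; first by [].
by move: C1; rewrite -/s1 /=; set u := iter _ _ _; lia.
Qed.

Lemma runSeq c1 c2 s : run (c1 ;; c2) s = run c2 (run c1 s). Proof. by []. Qed.

Lemma costSeq c1 c2 s : cost (c1 ;; c2) s = cost c1 s + cost c2 (run c1 s).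
Proof. by []. Qed.

Lemma runSeq3 c1 c2 c3 s : run (c1 ;; c2 ;; c3) s = run c3 (run c2 (run c1 s)).
Proof. by []. Qed.

Lemma costSeq3 c1 c2 c3 s : cost (c1 ;; c2 ;; c3) s =
  cost c1 s + (cost c2 (run c1 s) + cost c3 (run c2 (run c1 s))).
Proof. by []. Qed.

Lemma runIf x c1 c2 s : run (If x c1 c2) s = if 0 < var s x then run c1 s else run c2 s.
Proof. by []. Qed.

Lemma costIf x c1 c2 s :
  cost (If x c1 c2) s = if 0 < var s x then (cost c1 s).+1 else (cost c2 s).+2.
Proof. by []. Qed.

Definition seg (s : store) b (l : seq nat) :=
  forall k, k < size l -> arr s a_S (b + k) = nth 0 l k.

(** * Finding the cut by linear scans *)

Section Scanning.
Variables (m L D : nat) (al : nat -> nat).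

Definition tables (s : store) :=
  [/\ forall i, i < m -> arr s a_al i = al i,
      forall i, i < m -> arr s a_wt i = wt al i &
      forall j, j <= D -> arr s a_pow j = 2 ^ j].

Definition consts (s : store) :=
  [/\ var s v_one = 1, var s v_zero = 0, var s v_three = 3 & var s v_L = L].

Lemma wsum_take_rec S j : j < size S ->
  wsum al (take j.+1 S) = wsum al (take j S) + wt al (nth 0 S j).
Proof. by move=> Hj; rewrite (take_nth 0) // -cats1 wsum_cat /wsum big_seq1. Qed.

Lemma c_scanP s b S P : tables s -> consts s -> all (gtn m) S -> seg s b S ->
  var s v_sl = b -> var s v_ls = size S -> var s v_pw = P ->
  exists2 j, [/\ j <= size S, wsum al (take j S) <= P &
                 j = size S \/ P < wsum al (take j S) + wt al (nth 0 S j)] &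
    let s' := run c_scan s in
    [/\ var s' v_j = b + j, var s' v_acc = wsum al (take j S) &
        cost c_scan s <= 40 * (size S).+1].
Proof.
move=> [_ Hw _] [H1 H0 _ _] HS Hseg Hb Hls HP.
rewrite /c_scan; set c1 := (c in Loop _ c).
set s1 := run (Const v_acc 0 ;; Plus v_j v_sl v_zero ;; Plus v_cnt v_ls v_zero) s.
have E1 : var s1 v_cnt = size S by rewrite /s1 /= /set_reg /= Hls H0 addn0.
pose I k s' := exists2 j, [/\ j <= k, wsum al (take j S) <= P &
   j = k \/ P < wsum al (take j S) + wt al (nth 0 S j)] &
   var s' v_j = b + j /\ var s' v_acc = wsum al (take j S).
have [] := @loopP v_cnt c1 s1 I 25.
- by [].
- exists 0; last by rewrite /s1 /= /set_reg /= Hb H0 take0 /wsum big_nil !addn0.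
  by rewrite take0 /wsum big_nil; split=> //; left.
- move=> k s' Hk [j [Hj1 Hj2 Hj3] [Ej Ea]] Fv Fa s2; split; last by apply: leq_trans (cost_loopfree _ _) _.
  rewrite E1 in Hk; have HjS : j < size S by exact: leq_ltn_trans Hk.
  have Hm : nth 0 S j < m by apply: (allP HS); exact: mem_nth.
  have A3 : arr s' a_S (b + j) = nth 0 S j by rewrite Fa // -Hseg.
  have A1 : arr s' a_wt (nth 0 S j) = wt al (nth 0 S j) by rewrite Fa // -Hw.
  have V1 : var s' v_one = 1 by rewrite Fv.
  have V0 : var s' v_zero = 0 by rewrite Fv.
  have VP : var s' v_pw = P by rewrite Fv.
  rewrite /s2 /c1 /= /set_reg /= Ej A3 A1 Ea VP.
  have [Hlt|Hge] := ltnP P (wsum al (take j S) + wt al (nth 0 S j)).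
    rewrite subn_gt0 Hlt; exists j; last by rewrite /= /set_reg /= Ej Ea.
    by split=> //; [exact: leqW | right].
  rewrite subn_gt0 ltnNge Hge /=; exists j.+1; last first.
    by rewrite wsum_take_rec // /= /set_reg /= V0 V1 addn0 addn1 addnS.
  rewrite wsum_take_rec //; split=> //; left; congr _.+1.
  by case: Hj3 => //; rewrite ltnNge Hge.
rewrite E1 => -[j [Hj1 Hj2 Hj3] [Ej Ea]] Hc; exists j => //; split=> //.
by move: Hc; rewrite -/s1 /=; set u := iter _ _ _; lia.
Qed.

Lemma c_tscan3P s : let s' := run c_tscan3 s in
  let v := arr s a_wt (var s v_p1) in
  if var s v_t + var s v_acc + v + v <= var s v_pw then
    [/\ var s' v_p = var s v_p1 + var s v_one, var s' v_k = var s v_k + var s v_one &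
        var s' v_X = var s v_X2 + v]
  else [/\ var s' v_p = var s v_p, var s' v_k = var s v_k & var s' v_X = var s v_X].
Proof. by rewrite /= /set_reg /= subn_gt0 ltnNge; case: leqP. Qed.

(** The running sum [v_X] is the weight of the chain before the current cut, so a round is dominated
    by one product with [2 (d - 2)] and costs [O(d)]. In the invariant, [j = k] means that the scan
    has not yet stopped; after [hi - lo] rounds this would contradict [lo + 2 j < hi]. *)
Lemma c_tscanP s lo hi d n : tables s -> consts s -> lo < hi <= m ->
  var s v_tl = lo -> var s v_th = hi -> var s v_N = hi - lo -> var s v_d1 = d.-1 ->
  var s v_acc = n -> var s v_pw = 2 ^ d.-1 ->
  let fit p := n + 2 * d.-2 * wint al lo p.-1 + 2 * wt al p.-1 <= 2 ^ d.-1 in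
  exists2 k, [/\ lo + 2 * k < hi, k = 0 \/ fit (lo + 2 * k) &
                 hi <= (lo + 2 * k).+2 \/ ~~ fit (lo + 2 * k).+2] &
    let s' := run c_tscan s in
    [/\ var s' v_p = lo + 2 * k, var s' v_k = k.+1 &
        cost c_tscan s <= (8 * d + 60) * (hi - lo).+1].
Proof.
move=> [_ Hw _] [H1 H0 _ _] /andP[Hlt Hhm] Htl Hth HN Hd1 Hacc Hpw fit.
rewrite /c_tscan; set c0 := (c in Seq c _); set c1 := (c in Loop _ c).
set s1 := run c0 s.
have E1 : var s1 v_cnt = hi - lo by rewrite /s1 /= /set_reg /= HN H0 addn0.
have Ee : var s1 v_e = 2 * d.-2.
  by rewrite /s1 /= /set_reg /= Hd1 H1; lia.
pose I k s' := exists2 j, [/\ j <= k, lo + 2 * j < hi, j = 0 \/ fit (lo + 2 * j) &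
   j = k \/ hi <= (lo + 2 * j).+2 \/ ~~ fit (lo + 2 * j).+2] &
   [/\ var s' v_p = lo + 2 * j, var s' v_k = j.+1 & var s' v_X = wint al lo (lo + 2 * j)].
have [] := @loopP v_cnt c1 s1 I (8 * d + 57).
- by [].
- exists 0.
    by rewrite muln0 addn0; split=> //; left.
  by rewrite /s1 /= /set_reg /= Htl H0 muln0 addn0 /wint big_geq.
- move=> k s' Hk [j [Hj1 Hj2 Hj3 Hj4] [Ep Ek EX]] Fv Fa s2.
  have V1 : var s' v_one = 1 by rewrite Fv.
  have V0 : var s' v_zero = 0 by rewrite Fv.
  have VP : var s' v_pw = 2 ^ d.-1 by rewrite Fv.
  have Vth : var s' v_th = hi by rewrite Fv.
  have Vacc : var s' v_acc = n by rewrite Fv.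
  have Ve : var s' v_e = 2 * d.-2 by rewrite Fv.
  rewrite /c1 runSeq costSeq runIf costIf.
  have C3 : cost c_tscan1 s2 = 3 by [].
  set s3 := run c_tscan1 s2.
  have Hj : j = k \/ hi <= (lo + 2 * j).+2 \/ ~~ fit (lo + 2 * j).+2 by [].
  have T3 : var s3 v_t = hi - (lo + 2 * j).+2.
    by rewrite /s3 /= /set_reg /= V1 Vth Ep !addn1.
  have P3 : var s3 v_p1 = (lo + 2 * j).+1 by rewrite /s3 /= /set_reg /= V1 Ep addn1.
  have A3 : arr s3 = arr s' by [].
  have F3 y : y \notin [:: v_cnt; v_p1; v_t] -> var s3 y = var s' y.
    rewrite !inE !negb_or => /and3P[/negbTE y1 /negbTE y2 /negbTE y3].
    by rewrite /s3 /= /set_reg y1 y2 y3.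
  rewrite C3 T3 subn_gt0; clearbody s3; case: (ltnP _ hi) => Hhi; last first.
    split; last by rewrite /=; lia.
    exists j; first by split=> //; [lia | right; left].
    by rewrite /= !F3.
  rewrite 2!runSeq 2!costSeq.
  have C4 : cost c_tscan2 s3 = 8 by [].
  have A4 : arr (run c_tscan2 s3) = arr s' by [].
  have X4 : var (run c_tscan2 s3) v_X2 = wint al lo (lo + 2 * j).+1.
    by rewrite wint_recr ?leq_addr // /= /set_reg /= !F3 // Ep EX A3 Fa // Hw //; lia.
  have F4 y : y \notin [:: v_y; v_X2] -> var (run c_tscan2 s3) y = var s3 y.
    by move=> Hy; rewrite frame_var.
  rewrite C4; move: (run c_tscan2 s3) A4 X4 F4 => s4 A4 X4 F4.
  have := @c_mulP v_t v_e v_X2 s4 isT isT isT isT; rewrite (F4 38) // (F4 14) // (F3 38) // (F3 14) // V0 Ve X4 => /(_ erefl)[].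
  have := @frame_arr (c_mul v_t v_e v_X2) s4.
  have := @frame_var (c_mul v_t v_e v_X2) s4.
  move: (cost (c_mul _ _ _) _) (run (c_mul _ _ _) _) => cm s5 F5 A5 T5 C5.
  have P5 : var s5 v_p1 = (lo + 2 * j).+1 by rewrite F5 // F4.
  have X5 : var s5 v_X2 = wint al lo (lo + 2 * j).+1 by rewrite F5.
  have {}F5 y : y \notin [:: v_cnt; v_p1; v_t; v_y; v_X2; v_mc] -> var s5 y = var s' y.
    rewrite !inE !negb_or => /and5P[y1 y2 y3 y4 /andP[y5 y6]].
    by rewrite F5 ?F4 ?F3 // !inE ?negb_or ?y1 ?y2 ?y3 ?y4 ?y5 ?y6.
  have C6 : cost c_tscan3 s5 <= 20 by apply: leq_trans (cost_loopfree _ _) _.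
  split; last by move: C5 C6; clear; lia.
  have Wz : arr s5 a_wt (lo + 2 * j).+1 = wt al (lo + 2 * j).+1.
    by rewrite A5 // A4 Fa // Hw //; lia.
  have Efit : fit (lo + 2 * j).+2 = 
      (2 * d.-2 * wint al lo (lo + 2 * j).+1 + n + wt al (lo + 2 * j).+1 + wt al (lo + 2 * j).+1
         <= 2 ^ d.-1) by rewrite /fit /=; congr (_ <= _); lia.
  have E2 : lo + 2 * j.+1 = (lo + 2 * j).+2 by lia.
  have E3 := @wint_recr al lo (lo + 2 * j).+1 (leqW (leq_addr _ _)).
  have V : [/\ var s5 v_pw = 2 ^ d.-1, var s5 v_acc = n, var s5 v_one = 1 &
      [/\ var s5 v_p = lo + 2 * j, var s5 v_k = j.+1 & var s5 v_X = wint al lo (lo + 2 * j)]].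
    by rewrite !F5.
  case: V => W1 W2 W3 [W4 W5 W6].
  have := @c_tscan3P s5; cbv zeta; rewrite T5 P5 Wz X5 W1 W2 W3 -Efit.
  move: (run c_tscan3 s5) => s6; case: ifP => Hf [K1 K2 K3].
    exists j.+1; last by rewrite E2 K1 K2 K3 W5 E3 !addn1.
    rewrite E2; split=> //; first by right.
    by left; case: Hj4 => [->|[|]] //; [lia | rewrite Hf].
  exists j; last by rewrite K1 K2 K3.
  by split=> //; [lia | right; right; rewrite Hf].
rewrite E1 => -[j [Hj1 Hj2 Hj3 Hj4] [Ep Ek EX]] Hc; exists j.
  split=> //; case: Hj4 => //; lia.
split=> //; rewrite costSeq (_ : cost c0 s = 6) //.
by move: (cost _ _) Hc Hlt => u; clear; lia.
Qed.

(** * Bucket sort by decreasing arrival time *)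

Definition level n (O : seq nat) := [seq x <- O | al x == L - n].

Definition levels n O := flatten [seq level i O | i <- iota 0 n].

Lemma levelsS n O : levels n.+1 O = levels n O ++ level n O.
Proof. by rewrite /levels -addn1 iotaD map_cat flatten_cat /= cats0. Qed.

(** Up to [n = L + 1] the truncated differences [L - i] are distinct; beyond that bucket 0 would be
    collected again. *)
Lemma levels_perm n O : n <= L.+1 -> perm_eq (levels n O) [seq x <- O | L < al x + n & al x <= L].
Proof.
elim: n => [|n IH] Hn.
  rewrite /levels /= (eq_filter (a2 := pred0)) ?filter_pred0 // => x.
  by rewrite addn0 ltnNge andNb.
rewrite levelsS; apply/permP => a; rewrite count_cat (permP (IH (ltnW Hn))).
rewrite /level !count_filter -count_predUI.
rewrite [X in _ + X](eq_count (a2 := pred0)) ?count_pred0 ?addn0; last first.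
  by move=> x /=; case: eqP => // E; rewrite andbC -!andbA; case: (a x) => //=; lia.
by apply: eq_count => x /=; case: (a x) => //=; lia.
Qed.

Lemma levels_perm_all O : {in O, forall i, al i <= L} -> perm_eq (levels L.+1 O) O.
Proof.
move=> H; apply: perm_trans (levels_perm _ (leqnn _)) _.
rewrite (_ : filter _ O = O) //; apply/all_filterP/allP => x /H /=; lia.
Qed.

Lemma levels_sorted n O : n <= L.+1 -> sorted (heavier al) (levels n O).
Proof.
move=> Hn; rewrite (sorted_pairwise (@heavier_trans al)).
elim: n Hn => [//|n IH] Hn; rewrite levelsS pairwise_cat IH ?(ltnW Hn) //=; apply/andP; split.
  apply/allrelP => x y; rewrite (perm_mem (levels_perm _ (ltnW Hn))) !mem_filter /heavier.
  by move=> /andP[/andP[H1 _] _] /andP[/eqP H2 _]; lia.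
have := filter_all (fun x => al x == L - n) O; rewrite -/(level n O).
elim: (level n O) => //= x l IHl /andP[/eqP E H]; rewrite IHl // andbT.
by apply/allP => y /(allP H) /eqP E2; rewrite /heavier E E2.
Qed.

Lemma seg_rcons s b l (s' : store) x : seg s b l ->
  (forall q, q < b + size l -> arr s' a_S q = arr s a_S q) -> arr s' a_S (b + size l) = x ->
  seg s' b (rcons l x).
Proof.
move=> Hs Ha Hx k; rewrite size_rcons ltnS nth_rcons leq_eqVlt => /orP[/eqP ->|Hk].
  by rewrite ltnn eqxx.
by rewrite Hk Ha ?ltn_add2l // Hs.
Qed.

Lemma c_selectP s b l x : tables s -> var s v_one = 1 -> x < m -> var s v_x = x ->
  var s v_sp = b + size l -> seg s b l ->
  let s' := run c_select s in
  let l' := l ++ [seq y <- [:: x] | al y == var s v_c1] in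
  [/\ var s' v_x = x + 2, var s' v_sp = b + size l', seg s' b l' &
     forall q, q < b -> arr s' a_S q = arr s a_S q].
Proof.
move=> [Ha _ _] H1 Hx Ex Hsp Hl.
have E2 : (0 < al x - var s v_c1 + (var s v_c1 - al x)) = (al x != var s v_c1) by lia.
rewrite /c_select 5!runSeq.
set s1 := run (Plus v_t2 v_t2 v_t3) _.
have T2 : var s1 v_t2 = al x - var s v_c1 + (var s v_c1 - al x).
  by rewrite /s1 /= /set_reg /= Ex Ha.
have X1 : var s1 v_x = x by [].
have O1 : var s1 v_one = 1 by [].
have S1 : var s1 v_sp = b + size l by [].
have A1 : arr s1 = arr s by [].
clearbody s1.
rewrite runIf T2 E2 /=; case: eqP => E; rewrite /= /set_reg /= ?X1 ?O1 ?S1 ?A1.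
  rewrite size_cat /= -addnA; split=> //; first by rewrite addnA.
    rewrite cats1; apply: (seg_rcons Hl) => [q Hq|] /=; rewrite /= ?S1 ?X1 ?A1 ?eqxx //.
    by case: eqP => //=; lia.
  by move=> q Hq; case: eqP => //=; lia.
rewrite cats0 -addnA; split=> // k Hk; rewrite /= A1; exact: Hl.
Qed.

Lemma oddsS lo k : odds lo k.+1 = odds lo k ++ [:: lo + 2 * k].
Proof. by rewrite /odds -[k.+1]addn1 iotaD map_cat. Qed.

Lemma c_filterP s lo K : tables s -> consts s -> var s v_tl = lo -> var s v_k = K ->
  (forall i, i < K -> lo + 2 * i < m) ->
  let O := odds lo K in let b := var s v_sp in let s' := run c_filter s in
  [/\ var s' v_sp0 = b, var s' v_sp = b + size (levels L.+1 O), seg s' b (levels L.+1 O) &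
    forall q, q < b -> arr s' a_S q = arr s a_S q] /\
  cost c_filter s <= (40 * K + 20) * L.+2.
Proof.
move=> [Ha Hw Hp] [H1 H0 H3 HL] Htl Hk HO O b s'.
have C0 : cost c_filter0 s = 2 by [].
have B0 : var (run c_filter0 s) v_sp0 = b by rewrite /= /set_reg /= H0 addn0.
have E0 : var (run c_filter0 s) v_c1 = L.+1 by rewrite /= /set_reg /= HL H1 addn1.
have SP : var (run c_filter0 s) v_sp = b by [].
have A0 : arr (run c_filter0 s) = arr s by [].
have F0 y : y \notin [:: v_sp0; v_c1] -> var (run c_filter0 s) y = var s y.
  by move=> Hy; rewrite frame_var.
rewrite /s' /c_filter runSeq costSeq C0 {C0 s'}.
move: (run c_filter0 s) B0 E0 SP A0 F0 => s0 B0 E0 SP A0 F0.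
pose I n s' := [/\ var s' v_sp = b + size (levels n O), seg s' b (levels n O) &
    forall q, q < b -> arr s' a_S q = arr s a_S q].
have := @loopP v_c1 (c_select0 ;; Loop v_c2 c_select) s0 I (40 * K + 4) isT.
have Hsp0 := @frame_var (Loop v_c1 (c_select0 ;; Loop v_c2 c_select)) s0 v_sp0 isT.
rewrite E0; case.
- by split=> [||q _]; rewrite ?SP ?addn0 ?A0.
- move=> n s' Hn [I1 I2 I3] Fv Fa s2; rewrite runSeq costSeq.
  have C1 : cost c_select0 s2 = 2 by [].
  have V1 : var (run c_select0 s2) v_x = lo.
    by rewrite /= /set_reg /= !Fv // !F0 // Htl H0 addn0.
  have V2 : var (run c_select0 s2) v_c2 = K.
    by rewrite /= /set_reg /= !Fv // !F0 // Hk H0 addn0.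
  have V3 : var (run c_select0 s2) v_c1 = L - n by rewrite /= /set_reg /= subSS.
  have V4 : var (run c_select0 s2) v_one = 1 by rewrite /= /set_reg /= Fv // F0.
  have V5 : var (run c_select0 s2) v_sp = b + size (levels n O) by rewrite /= /set_reg /= I1.
  have V6 : arr (run c_select0 s2) = arr s' by [].
  rewrite C1; move: (run c_select0 s2) V1 V2 V3 V4 V5 V6 => s3 V1 V2 V3 V4 V5 V6.
  pose J i s'' := let l := levels n O ++ level n (odds lo i) in
    [/\ var s'' v_x = lo + 2 * i, var s'' v_sp = b + size l, seg s'' b l &
      forall q, q < b -> arr s'' a_S q = arr s a_S q].
  have [] := @loopP v_c2 c_select s3 J 35 isT.
  + rewrite /J /= cats0 muln0 addn0 V6; split=> // k; rewrite V6; exact: I2.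
  + move=> i s'' Hi [J1 J2 J3 J4] Fv' Fa' s4; rewrite V2 in Hi; split; last by apply: leq_trans (cost_loopfree _ _) _.
    have T4 : tables s4.
      by split=> j Hj; rewrite /= Fa' // V6 Fa // A0; [exact: Ha | exact: Hw | exact: Hp].
    have O4 : var s4 v_one = 1 by rewrite /s4 /= /set_reg /= Fv' // V4.
    have C4 : var s4 v_c1 = L - n by rewrite /s4 /= /set_reg /= Fv' // V3.
    have := @c_selectP s4 b _ (lo + 2 * i) T4 O4 (HO _ Hi) J1 J2 J3.
    rewrite C4 -catA /J oddsS /level filter_cat => -[-> -> S4 S5]; split=> //.
      by rewrite mulnS addnAC addnA.
    by move=> q Hq; rewrite S5 // J4.
  rewrite V2 => -[J1 J2 J3 J4] CJ; split; last by move: CJ; clear; lia.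
  by rewrite /I levelsS.
move=> [I1 I2 I3] CI; split; first by rewrite Hsp0 B0.
by move: CI; clear; set u := cost _ _; rewrite -[L.+2]addn1 mulnDr muln1; nia.
Qed.

(** The symmetric variables form a segment of the common array [a_S]. Splitting them reuses the two
    halves of the segment; only the lists created by chain splits are appended, at [v_sp]. Segments
    end at or before [v_sp], so later appends leave them intact. *)
Definition holds (s : store) i (it : item) :=
  [/\ arr s a_f i = (if conj it then 1 else 2),
      arr s a_sh i = arr s a_sl i + size (syms it), arr s a_sh i <= var s v_sp,
      [/\ arr s a_tl i = lo it, arr s a_th i = hi it & arr s a_d i = dl it] &
      seg s (arr s a_sl i) (syms it)].

(** What processing an item preserves: the item records, kept in the arrays above [a_S], in all
    slots below [n], and the part of [a_S] already in use. *)
Definition later (n : nat) (s s' : store) :=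
  [/\ forall q i, a_S < q -> i < n -> arr s' q i = arr s q i,
      forall i, i < var s v_sp -> arr s' a_S i = arr s a_S i &
      var s v_sp <= var s' v_sp].

Lemma holds_later n s s' i it : later n s s' -> i < n -> holds s i it -> holds s' i it.
Proof.
move=> [L1 L2 L3] Hi [H1 H2 H3 [H4 H5 H6] H7]; split; rewrite ?L1 //.
  exact: leq_trans L3.
move=> k Hk; rewrite L2 ?H7 //; apply: leq_trans H3; rewrite H2; lia.
Qed.

Lemma later_trans n s s' s'' : later n s s' -> later n s' s'' -> later n s s''.
Proof.
move=> [L1 L2 L3] [M1 M2 M3]; split=> [q i Hq Hi|i Hi|].
- by rewrite M1 ?L1.
- by rewrite M2 ?L2 //; apply: leq_trans L3.
- exact: leq_trans M3.
Qed.

Lemma c_putP idx f sl sh tl th s it : let s' := run (c_put idx f sl sh tl th) s in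
  var s f = (if conj it then 1 else 2) -> var s sh = var s sl + size (syms it) ->
  var s sh <= var s v_sp -> var s tl = lo it -> var s th = hi it -> var s v_d1 = dl it ->
  seg s (var s sl) (syms it) ->
  [/\ holds s' (var s idx) it, later (var s idx) s s', var s' = var s & arr s' a_S = arr s a_S].
Proof.
move=> s' H1 H2 H3 H4 H5 H6 H7; split; rewrite /s' //.
- by rewrite /holds /= eqxx; split=> // k Hk; rewrite /= eqxx; exact: H7.
- split=> // q i _ Hi; rewrite /= (ltn_eqF Hi); by rewrite !andbF.
Qed.

Definition loaded (s : store) (it : item) (n : nat) :=
  [/\ var s v_f = (if conj it then 1 else 2),
      var s v_sh = var s v_sl + size (syms it), var s v_sh <= var s v_sp,
      seg s (var s v_sl) (syms it) &
      [/\ var s v_tl = lo it, var s v_th = hi it, var s v_N = hi it - lo it,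
          var s v_ls = size (syms it) &
          [/\ var s v_d1 = (dl it).-1, var s v_pw = 2 ^ (dl it).-1 & var s v_tail = n]]].

Lemma c_splitSP s it n j : loaded s it n -> var s v_t2 = n.+1 -> var s v_zero = 0 ->
  var s v_j = var s v_sl + j -> j <= size (syms it) ->
  let s' := run c_splitS s in
  [/\ holds s' n (Item (conj it) (take j (syms it)) 0 0 (dl it).-1),
      holds s' n.+1 (Item (conj it) (drop j (syms it)) (lo it) (hi it) (dl it).-1),
      later n s s' & var s' = var s].
Proof.
move=> [Hf Hsh Hsp Hseg [Htl Hth HN Hls [Hd1 Hpw Htail]]] Ht2 H0 Hj Hjs s'.
rewrite /s' /c_splitS runSeq.
have [|||||||P1 P2 P3 P4] := @c_putP v_tail v_f v_sl v_j v_zero v_zero s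
   (Item (conj it) (take j (syms it)) 0 0 (dl it).-1); try by [].
- by rewrite size_takel.
- by rewrite Hj; move: Hsp; rewrite Hsh; lia.
- move=> k; rewrite size_takel // => Hk; rewrite Hseg ?nth_take //; lia.
move: (run _ s) P1 P2 P3 P4 => s1 P1 P2 P3 P4.
have [|||||||Q1 Q2 Q3 Q4] := @c_putP v_t2 v_f v_j v_sh v_tl v_th s1
   (Item (conj it) (drop j (syms it)) (lo it) (hi it) (dl it).-1); rewrite ?P3; try by [].
- by rewrite size_drop Hsh Hj; lia.
- move=> k; rewrite size_drop => Hk; rewrite /seg Hj P4 -addnA Hseg ?nth_drop //; lia.
move: (run _ s1) Q1 Q2 Q3 Q4 => s2 Q1 Q2 Q3 Q4; rewrite P3 Htail ?Ht2 in P1 P2 Q1 Q2.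
split=> //; first exact: holds_later Q2 _ P1.
  apply: later_trans P2 _; case: Q2 => Q5 Q6 Q7; split=> // q i Hq Hi.
  by rewrite Q5 // ltnS ltnW.
Qed.

End Scanning.

(** * Processing one item *)

Section Splitting.
Variables (m L D : nat) (al : nat -> nat).
Local Notation tables := (tables m D al).
Local Notation consts := (consts L).
Local Notation levels := (levels L al).

Lemma c_splitTP s it n : (forall i, i < m -> al i <= L) ->
  tables s -> consts s -> loaded s it n -> valid m al it ->
  0 < dl it -> lo it < hi it -> var s v_acc = wsum al (syms it) ->
  wsum al (syms it) <= 2 ^ (dl it).-1 ->
  let s' := run c_splitT s in
  exists c1 c2, [/\ splits m al it c1 c2, holds s' n c1, holds s' n.+1 c2, later n s s' &
    cost c_splitT s <= (8 * dl it + 40 * L + 300) * (hi it - lo it).+2].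
Proof.
move=> HL Ht Hc Hl Hv Hd Hlt Hacc Hw s'.
have [Hf Hsh Hsp Hseg [Htl Hth HN Hls [Hd1 Hpw Htail]]] := Hl.
have Hlm : lo it < hi it <= m by case: Hv => _ _ _ /andP[_ ->] _; rewrite Hlt.
have [k [Hk1 Hk2 Hk3]] := c_tscanP Ht Hc Hlm Htl Hth HN Hd1 Hacc Hpw.
rewrite {}/s' /c_splitT runSeq costSeq.
have Fv1 y := @frame_var c_tscan s y; have Fa1 y := @frame_arr c_tscan s y.
move: (cost c_tscan s) (run c_tscan s) Fv1 Fa1 => u1 s1 Fv1 Fa1 [P1 P2 P3].
have Ht1 : tables s1 by case: Ht => ? ? ?; split=> *; rewrite Fa1 //; auto.
have Hc1 : consts s1 by case: Hc => *; split; rewrite Fv1.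
have Hkm i : i < k.+1 -> lo it + 2 * i < m by move: Hlm; lia.
have [] := c_filterP Ht1 Hc1 _ P2 Hkm; first by rewrite Fv1 //; exact: Htl.
rewrite runSeq costSeq.
have Fv2 y := @frame_var c_filter s1 y; have Fa2 y := @frame_arr c_filter s1 y.
move: (cost c_filter s1) (run c_filter s1) Fv2 Fa2 => u2 s2 Fv2 Fa2 [Q1 Q2 Q3 Q4] Q5.
set F := levels _ _ in Q2 Q3.
have HF : perm_eq F (odds (lo it) k.+1).
  by apply: levels_perm_all => i /mapP[j]; rewrite mem_iota => /andP[_ Hj] ->; apply: HL; exact: Hkm.
have HFs : sorted (heavier al) F by exact: levels_sorted.
have [V1 V2 V3 _] := Hc.
have E y : y \notin writes c_tscan ++ writes c_filter -> var s2 y = var s y.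
  by rewrite mem_cat negb_or => /andP[H1 H2]; rewrite Fv2 ?Fv1.
rewrite (runSeq3 c_splitT0) (costSeq3 c_splitT0).
have C3 : cost c_splitT0 s2 = 3 by [].
have C4 t : cost (c_put v_tail v_f v_sl v_sh v_tl v_p) t = 42 by [].
have C5 t : cost (c_put v_t2 v_g v_sp0 v_sp v_p1 v_th) t = 42 by [].
rewrite C3 C4 C5 {C3 C4 C5}.
set s3 := run c_splitT0 s2.
have L3 : later n s s3.
  split=> [q i Hq Hi|i Hi|] /=.
  + by rewrite Fa2 ?Fa1 // inE; lia.
  + by rewrite Q4 ?Fa1 //= Fv1.
  + by rewrite /s3 /= /set_reg /= Q2 Fv1 // leq_addr.
have E3 y : y \notin [:: v_t2; v_g; v_p1] -> var s3 y = var s2 y.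
  rewrite !inE !negb_or => /and3P[/negbTE y1 /negbTE y2 /negbTE y3].
  by rewrite /s3 /= /set_reg y1 y2 y3.
have T2 : var s3 v_t2 = n.+1 by rewrite /s3 /= /set_reg /= !E // Htail V1 addn1.
have TG : var s3 v_g = if ~~ conj it then 1 else 2.
  by rewrite /s3 /= /set_reg /= !E // V3 Hf; case: conj.
have TP : var s3 v_p1 = (lo it + 2 * k).+1.
  by rewrite /s3 /= /set_reg /= (E v_one) // V1 addn1 Fv2 // P1.
have A3 : arr s3 = arr s2 by [].
have S3 : splits m al it (Item (conj it) (syms it) (lo it) (lo it + 2 * k) (dl it).-1)
    (Item (~~ conj it) F (lo it + 2 * k).+1 (hi it) (dl it).-1).
  by apply: splitT.
exists (Item (conj it) (syms it) (lo it) (lo it + 2 * k) (dl it).-1),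
  (Item (~~ conj it) F (lo it + 2 * k).+1 (hi it) (dl it).-1).
have X1 : var s3 v_sp0 = var s v_sp by rewrite E3 // Q1 Fv1.
have X2 : var s3 v_sp = var s v_sp + size F by rewrite E3 // Q2 Fv1.
have X3 : [/\ var s3 v_f = var s v_f, var s3 v_sl = var s v_sl, var s3 v_sh = var s v_sh,
    var s3 v_tl = var s v_tl & [/\ var s3 v_th = var s v_th, var s3 v_d1 = var s v_d1,
    var s3 v_p = lo it + 2 * k & var s3 v_tail = n]].
  split; [by rewrite E3 ?E|by rewrite E3 ?E|by rewrite E3 ?E|by rewrite E3 ?E|].
  by split; [rewrite E3 ?E|rewrite E3 ?E|rewrite E3 // Fv2|rewrite E3 ?E].
have S5 : seg s3 (var s v_sl) (syms it).
  move=> i Hi; rewrite A3 Q4 ?Fa1 // ?Hseg // Fv1 //; apply: leq_trans Hsp; rewrite Hsh; lia.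
have S6 : seg s3 (var s v_sp) F by rewrite -(Fv1 v_sp isT).
clearbody s3; case: X3 => [Y1 Y2 Y3 Y4 [Y5 Y6 Y7 Y8]].
have [|||||||R1 R2 R3 R4] := @c_putP v_tail v_f v_sl v_sh v_tl v_p s3
   (Item (conj it) (syms it) (lo it) (lo it + 2 * k) (dl it).-1);
  rewrite ?Y1 ?Y2 ?Y3 ?Y4 ?Y6 ?X2; try by [].
  exact: leq_trans (leq_addr _ _).
move: (run _ s3) R1 R2 R3 R4 => s4 R1 R2 R3 R4.
have [|||||||U1 U2 U3 U4] := @c_putP v_t2 v_g v_sp0 v_sp v_p1 v_th s4
   (Item (~~ conj it) F (lo it + 2 * k).+1 (hi it) (dl it).-1);
  rewrite ?R3 ?X1 ?X2 ?Y5 ?Y6; try by [].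
  by move=> i Hi; rewrite R4 S6.
move: (run _ s4) U1 U2 U3 U4 => s5 U1 U2 U3 U4; rewrite R3 ?Y8 ?T2 in R1 R2 U1 U2.
split=> //; first exact: holds_later U2 _ R1.
  apply: later_trans L3 _; apply: later_trans R2 _; case: U2 => U5 U6 U7; split=> // q i Hq Hi.
  by rewrite U5 // ltnS ltnW.
have Hkn : k.+1 <= hi it - lo it by lia.
move: P3 Q5 Hkn; move: (hi it - lo it) (dl it) => N d; clear => H1 H2 H3.
have : (40 * k.+1 + 20) * L.+2 <= (40 * N + 20) * L.+2 by rewrite leq_mul2r leq_add2r leq_mul2l H3 !orbT.
rewrite /=; nia.
Qed.

Lemma c_adjustP s : var s v_one = 1 ->
  let j := if 0 < var s v_sh - var s v_j + var s v_N then var s v_j else (var s v_j).-1 in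
  let s' := run c_adjust s in
  [/\ var s' v_j = j, var s' v_t = var s v_sh - j, var s' v_t2 = (var s v_tail).+1 &
      sout s' = sout s ++ [:: var s v_f; var s v_tail; (var s v_tail).+1]].
Proof.
move=> H1 j s'; rewrite {}/j -subn1.
rewrite /s' {s'}/c_adjust /= /set_reg /=.
by case: ifP => _; rewrite /= /set_reg /= ?H1 ?addn1 -!cats1 -?catA.
Qed.

Lemma c_innerP s it n : (forall i, i < m -> al i <= L) ->
  tables s -> consts s -> loaded s it n -> valid m al it -> dl it <= D ->
  1 < size (syms it) + (hi it - lo it) ->
  let s' := run c_inner s in
  exists c1 c2, [/\ splits m al it c1 c2, holds s' n c1, holds s' n.+1 c2, later n s s' &
    sout s' = sout s ++ [:: if conj it then 1 else 2; n; n.+1]] /\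
  cost c_inner s <= 3 * (8 * D + 40 * L + 300) * (size (syms it) + (hi it - lo it)).
Proof.
move=> HL Ht Hc Hl Hv HD Hbig s'.
have [Hd Hall] := valid_big Hv Hbig.
have [Hf Hsh Hsp Hseg [Htl Hth HN Hls [Hd1 Hpw Htail]]] := Hl.
have [V1 V2 V3 V4] := Hc.
have [Hv1 Hv2 Hv3 /andP[Hv4 _] Hv5] := Hv.
have S0 : 0 < size (syms it) by rewrite lt0n size_eq0.
rewrite {}/s' /c_inner runSeq3 costSeq3.
have [j [Hj1 Hj2 Hj3]] := c_scanP Ht Hc Hv3 Hseg erefl Hls Hpw.
have Fv1 y := @frame_var c_scan s y; have Fa1 y := @frame_arr c_scan s y.
have [Fi1 Fo1] : sin (run c_scan s) = sin s /\ sout (run c_scan s) = sout s by apply: frame_io.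
move: (cost c_scan s) (run c_scan s) Fv1 Fa1 Fi1 Fo1 => u1 s1 Fv1 Fa1 Fi1 Fo1 [P1 P2 P3].
have [] := @c_adjustP s1; first by rewrite Fv1.
have Ca : cost c_adjust s1 <= 30 by apply: leq_trans (cost_loopfree _ _) _.
have Fv2 y := @frame_var c_adjust s1 y; have Fa2 y := @frame_arr c_adjust s1 y.
rewrite P1 !(Fv1 v_sh, Fv1 v_N, Fv1 v_tail, Fv1 v_f) // Hsh HN Htail Hf Fo1.
move: (cost c_adjust s1) (run c_adjust s1) Ca Fv2 Fa2 => u2 s2 Ca Fv2 Fa2.
rewrite subnDl => Q1 Q2 Q3 Q4.
have Fv y : y \notin writes c_scan ++ writes c_adjust -> var s2 y = var s y.
  by rewrite mem_cat negb_or => /andP[H1 H2]; rewrite Fv2 ?Fv1.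
have Fa y : arr s2 y = arr s y by rewrite Fa2 ?Fa1.
have Ht2 : tables s2 by case: Ht => ? ? ?; split=> *; rewrite Fa; auto.
have Hc2 : consts s2 by split; rewrite Fv.
have Hl2 : loaded s2 it n.
  by rewrite /loaded !Fv //; split=> // k Hk; rewrite Fa; exact: Hseg.
have L2 : later n s s2 by split=> [q i _ _|i _|]; rewrite ?Fa ?Fv.
have Lt s3 : later n s2 s3 -> later n s s3 by exact: later_trans.
have Bnd u3 : u3 <= 2 + (8 * D + 40 * L + 300) * (hi it - lo it).+2 ->
    u1 + (u2 + u3) <= 3 * (8 * D + 40 * L + 300) * (size (syms it) + (hi it - lo it)).
  move: P3 Ca; move: (hi it - lo it) (size (syms it)) S0 => N z z0; clear -z0 => H1 H2 H3.
  nia.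
rewrite runIf costIf Q2.
case: ifP => Ht3.
  set j' := if _ then _ else _ in Q1 Q2 Ht3.
  have [i Ei Hi] : exists2 i, j' = var s v_sl + i & 0 < i < size (syms it) /\
      (wsum al (take i (syms it)) <= 2 ^ (dl it).-1 /\
      (wsum al (take i (syms it)) = 2 ^ (dl it).-1 \/
       hi it = lo it /\ wsum al (drop i (syms it)) <= 2 ^ (dl it).-1)).
    rewrite {}/j' in Q1 Q2 Ht3 *; move: Ht3; case: (ltnP 0 (_ - j + _)) => H1 Ht3.
      have Hjs : j < size (syms it) by lia.
      have Hj4 : 2 ^ (dl it).-1 < wsum al (take j (syms it)) + wt al (nth 0 (syms it) j).
        by case: Hj3 => // E; rewrite E ltnn in Hjs.
      exists j => //; rewrite Hjs andbT; split.
        (* The first symmetric variable alone is within the budget, so the prefix is not empty. *)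
        rewrite lt0n; apply/eqP => E; move: Hj4; rewrite E take0 /wsum big_nil add0n ltnNge.
        by rewrite /wt leq_exp2l // (allP Hall) // mem_nth.
      split=> //; left; exact: greedy_exact Hv2 Hjs Hall Hj2 Hj4.
    (* All symmetric variables together fit into half the budget and there is no chain, so any cut
       will do; cutting off the last variable keeps both parts nonempty. *)
    have [Ej EN] : j = size (syms it) /\ hi it = lo it by lia.
    have Hsum : wsum al (syms it) <= 2 ^ (dl it).-1 by rewrite Ej take_size in Hj2.
    exists j.-1; first by lia.
    rewrite -(cat_take_drop j.-1 (syms it)) wsum_cat in Hsum.
    by split; [lia | split; [lia | right; split; [|lia]]].
  have [Hi1 [Hi2 Hi3]] := Hi; have Hi4 : i <= size (syms it) by lia.
  have Hz : var s2 v_zero = 0 by rewrite Fv.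
  have Hj : var s2 v_j = var s2 v_sl + i by rewrite Q1 Ei Fv.
  have [] := @c_splitSP s2 it n i Hl2 Q3 Hz Hj Hi4.
  have -> : sout (run c_splitS s2) = sout s2 by case: (@frame_io c_splitS s2).
  have Cs : cost c_splitS s2 = 84 by [].
  rewrite Cs; move: (run _ s2) => s3 R1 R2 R3 R4.
  exists (Item (conj it) (take i (syms it)) 0 0 (dl it).-1),
    (Item (conj it) (drop i (syms it)) (lo it) (hi it) (dl it).-1).
  split; first by split=> //; [exact: splitS | exact: Lt].
  apply: Bnd; nia.
set j' := if _ then _ else _ in Q1 Q2 Ht3.
have [Ej EN] : j = size (syms it) /\ lo it < hi it.
  by move: Ht3; rewrite /j'; case: (ltnP 0 (_ - j + _)) => H; lia.
rewrite Ej take_size in P2 Hj2.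
have [|c1 [c2 [R1 R2 R3 R4 R5]]] := c_splitTP HL Ht2 Hc2 Hl2 Hv Hd EN _ Hj2.
  by rewrite Fv2.
exists c1, c2; split.
  split=> //; first exact: Lt.
  by rewrite -Q4; case: (@frame_io c_splitT s2).
apply: Bnd; rewrite !addSn add0n !ltnS; apply: leq_trans R5 _.
by rewrite leq_mul2r leq_add2r leq_add2r leq_mul2l HD !orbT.
Qed.

End Splitting.

(** * The queue of items and its amortized cost *)

Section Queue.
Variables (m L D : nat) (al : nat -> nat).
Hypothesis alL : forall i, i < m -> al i <= L.

Local Notation tables := (tables m D al).
Local Notation consts := (consts L).

Lemma c_loadP s i it n : tables s -> consts s -> holds s i it -> dl it <= D ->
  var s v_h = i -> var s v_tail = n ->
  let s' := run c_load s in
  [/\ loaded s' it n, var s' v_t = (size (syms it) + (hi it - lo it)).-1,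
      arr s' = arr s & sout s' = sout s].
Proof.
move=> [_ _ Hp] [H1 _ _ _] [E1 E2 E3 [E4 E5 E6] E7] HD Hh Hn s'.
have A : arr s' = arr s by [].
have Esl : var s' v_sl = arr s a_sl i by rewrite /s' /c_load /= /set_reg /= Hh.
split=> //; last first.
  by rewrite /s' /c_load /= /set_reg /= Hh E2 E4 E5 H1 addKn subn1 addnC.
split; rewrite ?Esl.
- by rewrite /s' /c_load /= /set_reg /= Hh.
- by rewrite /s' /c_load /= /set_reg /= Hh.
- by rewrite /s' /c_load /= /set_reg /= Hh.
- by move=> k Hk; rewrite A E7.
split; rewrite /s' /c_load /= /set_reg /= ?Hh ?E4 ?E5 ?E2 ?addKn //.
by rewrite H1 E6 subn1 Hp //; exact: leq_trans (leq_pred _) HD.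
Qed.

(** Here [its] lists all items created so far and [ch] the decisions for those already processed;
    the waiting items are those from index [size ch] on. Item [i] is stored in slot [i + 1], which
    is also its node number in the circuit, node 0 being the output. The leading numbers 3 and 1
    encode the output and its predecessor. *)
Definition queue_inv s its ch :=
  [/\ size ch <= size its, tables s, consts s,
      var s v_h = (size ch).+1 /\ var s v_tail = (size its).+1 &
  [/\ forall i, i < size its ->
        [/\ holds s i.+1 (nth item0 its i), valid m al (nth item0 its i) & dl (nth item0 its i) <= D],
      forall i, i < size ch -> node_ok m al its ch i,
      forall j, 0 < j < size its -> has_parent ch j &
      sout s = [:: 3; 1] ++ flatten [seq encode_item its ch i | i <- iota 0 (size ch)]]].

Lemma nth_rcons_lt (T : Type) (x0 : T) s x i : i < size s -> nth x0 (rcons s x) i = nth x0 s i.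
Proof. by move=> Hi; rewrite nth_rcons Hi. Qed.

Lemma node_ok_ext its ch its' o i : i < size ch -> size ch <= size its -> node_ok m al its ch i ->
  node_ok m al (its ++ its') (rcons ch o) i.
Proof.
move=> Hi Hs; rewrite /node_ok nth_rcons_lt //; case: (nth None ch i) => [c [H1 H2 H3]|].
  by rewrite size_cat !nth_cat H2 (ltnW H2) (leq_trans Hi Hs); split=> //; lia.
by rewrite nth_cat (leq_trans Hi Hs).
Qed.

Lemma encode_ext its ch its' o : size ch <= size its ->
  [seq encode_item (its ++ its') (rcons ch o) i | i <- iota 0 (size ch)] =
  [seq encode_item its ch i | i <- iota 0 (size ch)].
Proof.
move=> Hs; apply/eq_in_map => i; rewrite mem_iota add0n => /andP[_ Hi].
by rewrite /encode_item nth_rcons_lt // nth_cat (leq_trans Hi Hs).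
Qed.

Lemma has_parent_ext ch o j : has_parent ch j -> has_parent (rcons ch o) j.
Proof.
case=> i Hi Hp; exists i => //.
have Hs : i < size ch.
  by rewrite ltnNge; apply/negP => H; case: Hp; rewrite nth_default.
by rewrite nth_rcons_lt.
Qed.

Definition queue_pot (its : seq item) (ch : seq (option nat)) :=
  \sum_(size ch <= i < size its) pot (nth item0 its i).

(** The price of one unit of potential. A split costs at most three tenths of it per variable; the
    rest leaves room for loading, printing and queue management. *)
Definition unit_cost := 10 * (8 * D + 40 * L + 300).

Lemma later_refl n s s' : arr s' = arr s -> var s' v_sp = var s v_sp -> later n s s'.
Proof. by move=> E1 E2; split=> [q i _ _|i _|]; rewrite ?E1 ?E2. Qed.

(** A leaf gives up its whole potential, which is at least 1; a split releases at least one unit per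
    variable. Either way the release pays for the round and for the jump that follows it. *)
Lemma c_bodyP s its ch : queue_inv s its ch -> size ch < size its ->
  let s' := run c_body s in
  exists its' ch', [/\ queue_inv s' its' ch', var s' v_r = size its' - size ch',
      nth item0 its' 0 = nth item0 its 0 &
    cost c_body s + 1 + unit_cost * queue_pot its' ch' <= unit_cost * queue_pot its ch].
Proof.
move=> [Hsz Ht Hc [Hh Hn] [Hits Hch Hpar Hout]] Hlt s'.
set h := size ch in Hh Hlt *; set it := nth item0 its h.
have [Hhold Hval HD] := Hits _ Hlt; rewrite -/it in Hhold Hval HD.
have Hpot : queue_pot its ch = pot it + \sum_(h.+1 <= i < size its) pot (nth item0 its i).
  by rewrite /queue_pot big_ltn.
have [Hl Htl Ha Ho] := c_loadP Ht Hc Hhold HD Hh Hn.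
rewrite {}/s' /c_body runSeq3 costSeq3.
have Cl : cost c_load s <= 60 by apply: leq_trans (cost_loopfree _ _) _.
have Fl y := @frame_var c_load s y.
move: (cost c_load s) (run c_load s) Cl Fl Hl Htl Ha Ho => u0 s0 Cl Fl Hl Htl Ha Ho.
have Ht0 : tables s0 by rewrite /tables Ha.
have Hc0 : consts s0 by rewrite /consts !Fl.
have [K1 K2 K3 K4] := Hc0.
have Hsz' : 0 < size (syms it) by case: Hval; rewrite lt0n size_eq0.
rewrite runIf costIf Htl; case: ifP => Hbig; last first.
  have [Hs1 Hloh] : size (syms it) = 1 /\ hi it = lo it.
    have : lo it <= hi it by case: Hval => _ _ _ /andP[].
    by lia.
  case Ev: (syms it) Hs1 => [//|v [|]] // _.
  have Hvm : v < m by case: Hval; rewrite Ev /= andbT.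
  have Eleaf : sout (run c_leaf s0) = sout s ++ [:: 0; v].
    case: Hl => _ _ _ Hseg _; have := Hseg 0; rewrite Ev /= addn0 => /(_ isT) Ev0.
    by rewrite /= /set_reg /= K2 Ev0 Ho -!cats1 -catA.
  have Aleaf : arr (run c_leaf s0) = arr s by rewrite -Ha.
  have Cleaf : cost c_leaf s0 = 9 by [].
  have Fleaf y := @frame_var c_leaf s0 y.
  rewrite Cleaf; move: (run c_leaf s0) Eleaf Aleaf Fleaf => s1 Eleaf Aleaf Fleaf.
  have Fv y : y \notin writes c_load -> y \notin writes c_leaf -> y \notin writes c_next ->
      var (run c_next s1) y = var s y.
    by move=> H1 H2 H3; rewrite frame_var // Fleaf // Fl.
  exists its, (rcons ch None); split.
  - split; rewrite ?size_rcons //.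
    + by rewrite /tables /= Aleaf.
    + by rewrite /consts !Fv.
    + split; last by rewrite Fv.
      by rewrite /c_next /= /set_reg /= (Fleaf v_h) // (Fleaf v_one) // Fl // Hh K1 addn1.
    + split=> //.
      * move=> i Hi; have [H1 H2 H3] := Hits _ Hi; split=> //.
        by apply: (@holds_later i.+2 s) => //; apply: later_refl; [rewrite /= Aleaf | rewrite Fv].
      * move=> i; rewrite ltnS leq_eqVlt => /orP[/eqP ->|Hi]; last first.
          by rewrite -[its]cats0; apply: node_ok_ext => //; apply: Hch.
        rewrite /node_ok nth_rcons ltnn eqxx; exists v => //; split=> //.
        have [_ _ _ _] := Hval; rewrite /load Ev Hloh subnn addn0 /wsum big_seq1.
        by rewrite /wt leq_exp2l.
      * by move=> j Hj; apply: has_parent_ext; apply: Hpar.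
      * have -> : sout (run c_next s1) = sout s1 by case: (@frame_io c_next s1).
        rewrite Eleaf Hout -/h -[h.+1]addn1 iotaD map_cat flatten_cat -catA.
        have := encode_ext [::] None Hsz; rewrite cats0 -/h => ->.
        have EE : encode_item its (rcons ch None) h = [:: 0; v].
          by rewrite /encode_item nth_rcons ltnn eqxx -/it Ev.
        by rewrite /= add0n EE.
  - rewrite size_rcons /c_next /= /set_reg /= !(Fleaf v_h, Fleaf v_one, Fleaf v_tail) // !(Fl v_h, Fl v_tail) // Hh Hn K1 addn1; lia.
  - by [].
  - have Cn : cost c_next s1 = 2 by [].
    rewrite Hpot /queue_pot size_rcons Cn mulnDr.
    have : 1 <= pot it by rewrite /pot muln_gt0 /= addn_gt0 Hsz'.
    rewrite /unit_cost; set p := pot it; set q := \sum_(_ <= _ < _) _; nia.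
have Hbig' : 1 < size (syms it) + (hi it - lo it) by lia.
rewrite runSeq costSeq.
have [c1 [c2 [[R1 R2 R3 R4 R5] R6]]] := c_innerP alL Ht0 Hc0 Hl Hval HD Hbig'.
have Fi y := @frame_var c_inner s0 y; have Fia y := @frame_arr c_inner s0 y.
move: (cost c_inner s0) (run c_inner s0) R2 R3 R4 R5 R6 Fi Fia => u1 s1 R2 R3 R4 R5 R6 Fi Fia.
have Cg : cost c_grow s1 = 2 by [].
have Ag : arr (run c_next (run c_grow s1)) = arr s1 by [].
have Og : sout (run c_next (run c_grow s1)) = sout s1.
  by rewrite (proj2 (@frame_io c_next _ _)) // (proj2 (@frame_io c_grow _ _)).
have Fg y : y \notin writes c_grow -> y \notin writes c_next ->
    var (run c_next (run c_grow s1)) y = var s1 y.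
  by move=> H1 H2; rewrite !frame_var.
have Gh : var (run c_next (run c_grow s1)) v_h = h.+2.
  by rewrite /c_next /c_grow /= /set_reg /= !(Fi v_h, Fi v_one) // K1 Fl // Hh addn1.
have Gt : var (run c_next (run c_grow s1)) v_tail = (size its).+3.
  by rewrite /c_next /c_grow /= /set_reg /= !(Fi v_tail, Fi v_one) // K1 Fl // Hn !addn1.
have Gr : var (run c_next (run c_grow s1)) v_r = (size its).+3 - h.+2.
  by rewrite /c_next /c_grow /= /set_reg /= !(Fi v_h, Fi v_tail, Fi v_one) // K1 !(Fl v_h, Fl v_tail) // Hh Hn !addn1.
have Cn : cost c_next (run c_grow s1) = 2 by [].
rewrite Cg Cn; move: (run c_next _) Ag Og Fg Gh Gt Gr => s2 Ag Og Fg Gh Gt Gr.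
have Fv y : y \notin writes c_load -> y \notin writes c_inner -> y \notin writes c_grow ->
    y \notin writes c_next -> var s2 y = var s y.
  by move=> H1 H2 H3 H4; rewrite Fg // Fi // Fl.
have L2 : later (size its).+1 s s2.
  apply: (later_trans (s' := s0)); first by apply: later_refl; rewrite ?Ha ?Fl.
  by apply: later_trans R4 _; apply: later_refl; rewrite ?Ag ?Fg.
have S2 : later (size its).+3 s1 s2 by apply: later_refl; rewrite ?Ag ?Fg.
have [P1 P2 [P3 P4] P5 P6] := R1.
exists (its ++ [:: c1; c2]), (rcons ch (Some (size its))); split.
- split; rewrite ?size_rcons ?size_cat ?addn2 //.
  + by rewrite -/h; lia.
  + by rewrite /tables Ag; case: Ht0 => ? ? ?; split=> *; rewrite Fia //; auto.
  + by rewrite /consts !Fv.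
  + split.
    * move=> i; rewrite ltnS leq_eqVlt => /orP[/eqP ->|].
        rewrite nth_cat ltnNge leqnSn /= subSnn /=; split=> //; last by lia.
        by apply: holds_later S2 _ R3.
      rewrite ltnS leq_eqVlt => /orP[/eqP ->|Hi].
        rewrite nth_cat ltnn subnn /=; split=> //; last by lia.
        by apply: holds_later S2 _ R2; lia.
      have [H1 H2 H3] := Hits _ Hi; rewrite nth_cat Hi; split=> //.
      by apply: holds_later L2 _ H1.
    * move=> i; rewrite ltnS leq_eqVlt => /orP[/eqP ->|Hi]; last first.
        by apply: node_ok_ext => //; apply: Hch.
      rewrite /node_ok nth_rcons ltnn eqxx size_cat addn2; split=> //.
      by rewrite !nth_cat Hlt ltnn subnn ltnNge leqnSn /= subSnn.
    * move=> j /andP[Hj0 Hj].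
      have [Hjl|Hjg] := ltnP j (size its); first by apply: has_parent_ext; apply: Hpar; rewrite Hj0.
      exists h; first exact: leq_trans Hjg.
      rewrite nth_rcons ltnn eqxx.
      have [->|->] : j = size its \/ j = (size its).+1 by lia.
        by left.
      by right.
    * rewrite Og R5 Ho Hout -/h -[h.+1]addn1 iotaD map_cat flatten_cat -catA.
      have := encode_ext [:: c1; c2] (Some (size its)) Hsz; rewrite -/h => ->.
      have EE : encode_item (its ++ [:: c1; c2]) (rcons ch (Some (size its))) h =
          [:: if conj it then 1 else 2; (size its).+1; (size its).+2].
        by rewrite /encode_item nth_rcons ltnn eqxx nth_cat Hlt -/it.
      by rewrite /= add0n EE.
- by rewrite Gr size_cat size_rcons /= -/h; lia.
- by rewrite nth_cat (leq_ltn_trans (leq0n _) Hlt).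
- rewrite Hpot /queue_pot size_rcons size_cat /= (addn2 (size its)) -/h.
  rewrite big_nat_recr ?big_nat_recr /=; try lia.
  rewrite !nth_cat ltnn subnn ltnNge leqnSn /= subSnn /=.
  rewrite (eq_big_nat _ _ (F2 := fun i => pot (nth item0 its i))); last first.
    by move=> i /andP[_ Hi]; rewrite nth_cat Hi.
  move: P6; set q := \sum_(_ <= _ < _) _ => P6.
  have : unit_cost * (q + pot c1 + pot c2) + unit_cost * (size (syms it) + (hi it - lo it)) <=
      unit_cost * (pot it + q) by rewrite -mulnDr leq_mul2l; apply/orP; right; lia.
  move: R6 Cl Hbig'; rewrite /unit_cost; move: (_ + (hi it - lo it)) => z.
  clear; move=> H1 H2 H3 H4; nia.
Qed.

(** The scaled potential strictly decreases in every round, so it is the termination measure as well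
    as the time bound. *)
Lemma c_body_loop s its ch : queue_inv s its ch -> size ch < size its ->
  exists t s' its' ch', [/\ repeats c_body v_r s t s', queue_inv s' its' ch',
    size ch' = size its', nth item0 its' 0 = nth item0 its 0 &
    t <= unit_cost * queue_pot its ch].
Proof.
have [n] := ubnP (unit_cost * queue_pot its ch).
elim: n s its ch => // n IH s its ch Hn Hinv Hlt.
have [its1 [ch1 [Hinv1 Hr E0 Hcost]]] := c_bodyP Hinv Hlt.
have [Hle _ _ _ _] := Hinv1.
have [Hlt1|Hge1] := ltnP (size ch1) (size its1).
  have [|t [s' [its' [ch' [H1 H2 H3 H4 H5]]]]] := IH _ _ _ _ Hinv1 Hlt1; first by lia.
  exists (cost c_body s + t.+1), s', its', ch'; split=> //; last by lia.
    by apply: repeats_again => //; rewrite Hr subn_gt0.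
  by rewrite H4.
exists (cost c_body s).+1, (run c_body s), its1, ch1; split=> //; last by lia.
  by apply: repeats_stop; rewrite Hr; lia.
by apply/eqP; rewrite eqn_leq Hle.
Qed.

End Queue.

(** * Initialization *)

Definition c_read0 :=
  Const v_one 1 ;; Const v_three 3 ;; Const v_sp 1 ;; Read v_m ;; Plus v_cnt v_m v_zero.

Definition c_read :=
  Loop v_cnt (Read v_t ;; Put a_al v_i v_t ;; Monus v_t2 v_t v_max ;; Plus v_max v_max v_t2 ;;
    Plus v_i v_i v_one).

Definition c_log0 := Const v_pow 1 ;; Plus v_t3 v_m v_m ;; Plus v_cnt v_m v_zero.

Definition c_log :=
  Loop v_cnt (Monus v_t v_t3 v_pow ;; If v_t (Plus v_pow v_pow v_pow ;; Plus v_L v_L v_one) Skip).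

Definition c_pow0 :=
  Plus v_x v_L v_L ;; Plus v_x v_x v_x ;; Const v_pow 1 ;; Const v_i 0 ;; Plus v_cnt v_x v_one.

Definition c_pow := Loop v_cnt (Put a_pow v_i v_pow ;; Plus v_pow v_pow v_pow ;; Plus v_i v_i v_one).

Definition c_weight0 := Const v_i 0 ;; Plus v_cnt v_m v_zero.

(** Adding [L] before subtracting the maximum makes the truncated subtraction perform exactly the
    intended truncation at 0. *)
Definition c_weight :=
  Loop v_cnt (Get v_t a_al v_i ;; Plus v_t v_t v_L ;; Monus v_t v_t v_max ;; Put a_al v_i v_t ;;
    Get v_t2 a_pow v_t ;; Put a_wt v_i v_t2 ;; Plus v_tot v_tot v_t2 ;; Plus v_i v_i v_one).

Definition c_search0 :=
  Get v_w0 a_wt v_zero ;; Monus v_t v_m v_one ;; Get v_wl a_wt v_t ;;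
  Monus v_tot v_tot v_w0 ;; Monus v_tot v_tot v_wl ;; Plus v_cnt v_x v_zero.

Definition c_search1 := Monus v_e v_d v_one ;; Plus v_e v_e v_e.

Definition c_search2 :=
  Plus v_t v_t v_w0 ;; Plus v_t v_t v_wl ;; Plus v_t v_t v_wl ;; Get v_y a_pow v_d ;;
  Monus v_t v_t v_y ;; If v_t (Plus v_d v_d v_one) Skip.

Definition c_search := Loop v_cnt (c_search1 ;; c_mul v_t v_e v_tot ;; c_search2).

Definition c_root0 :=
  Const v_h 1 ;; Const v_tail 2 ;; Plus v_d1 v_d v_zero ;; Print v_three ;; Print v_one.

Definition c_init :=
  c_read0 ;; c_read ;; c_log0 ;; c_log ;; c_pow0 ;; c_pow ;; c_weight0 ;; c_weight ;;
  c_search0 ;; c_search ;; c_root0 ;; c_put v_h v_one v_zero v_one v_one v_m.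

Lemma c_readP s (a : nat -> nat) m : var s v_one = 1 -> var s v_i = 0 -> var s v_max = 0 ->
  var s v_cnt = m -> sin s = [seq a i | i <- iota 0 m] ->
  let s' := run c_read s in
  [/\ forall i, i < m -> arr s' a_al i = a i, var s' v_max = \max_(0 <= i < m) a i &
      sout s' = sout s] /\ cost c_read s <= 30 * m.+1.
Proof.
move=> H1 Hi Hmax Hcnt Hin; rewrite /c_read; set c := (c in Loop _ c).
have [] := @loopP v_cnt c s (fun k s' => [/\ var s' v_i = k, forall i, i < k -> arr s' a_al i = a i,
   var s' v_max = \max_(0 <= i < k) a i, sin s' = [seq a i | i <- iota k (m - k)] &
   sout s' = sout s]) 20 isT.
- by split=> //; rewrite ?big_geq ?subn0.
- move=> k s' Hk [I1 I2 I3 I4 I5] Fv Fa s1; split; last by apply: leq_trans (cost_loopfree _ _) _.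
  rewrite Hcnt in Hk; have Ek : m - k = (m - k.+1).+1 by lia.
  have O1 : var s' v_one = 1 by rewrite Fv.
  rewrite Ek /= in I4; rewrite /c /s1 /= /set_reg /= I1 I3 I4 /= O1 addn1; split=> //.
    move=> i; rewrite ltnS leq_eqVlt => /orP[/eqP ->|Hik]; first by rewrite eqxx.
    by rewrite (ltn_eqF Hik) I2.
  rewrite big_nat_recr //=; lia.
rewrite Hcnt => -[_ I2 I3 _ I5] Hc; split=> //.
by move: (cost _ _) Hc => u; clear; lia.
Qed.

Lemma c_logP s m : 3 <= m -> var s v_one = 1 -> var s v_pow = 1 -> var s v_L = 0 ->
  var s v_t3 = m + m -> var s v_cnt = m ->
  let L := var (run c_log s) v_L in
  2 * m <= 2 ^ L < 4 * m /\ cost c_log s <= 10 * m.+1.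
Proof.
move=> Hm H1 Hp H0 Ht Hcnt L; rewrite {}/L /c_log; set c := (c in Loop _ c).
have [] := @loopP v_cnt c s (fun k s' => let L := var s' v_L in
   [/\ var s' v_pow = 2 ^ L, 2 ^ L < 4 * m & L = k \/ 2 * m <= 2 ^ L]) 5 isT.
- by rewrite /= H0 Hp; split=> //; [lia | left].
- move=> k s' Hk [I1 I2 I3] Fv Fa s1; split; last by apply: leq_trans (cost_loopfree _ _) _.
  have O1 : var s' v_one = 1 by rewrite Fv.
  have O3 : var s' v_t3 = m + m by rewrite Fv.
  rewrite /c /s1 /= /set_reg /= I1 O3 O1; case: ifP => Hif; rewrite /= /set_reg /= ?I1.
    rewrite addn1 expnS; split; [lia | lia | left; case: I3 => [->//|]; lia].
  by split=> //; right; lia.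
rewrite Hcnt; move: (run _ s) => s' /= [_ I2 I3] Hc; split; last by lia.
rewrite I2 andbT; case: I3 => // ->.
(* If every round doubled the power, then [L = m], and [2 m <= 2^m] holds from [m = 3] on. *)
case: m Hm {I2 Hcnt Ht Hc} => [|[|[|m]]] // _; elim: m => // m IH.
by rewrite expnS; lia.
Qed.

Lemma c_powP s D : var s v_one = 1 -> var s v_pow = 1 -> var s v_i = 0 -> var s v_cnt = D.+1 ->
  (forall j, j <= D -> arr (run c_pow s) a_pow j = 2 ^ j) /\ cost c_pow s <= 20 * D.+2.
Proof.
move=> H1 Hp H0 Hcnt; rewrite /c_pow; set c := (c in Loop _ c).
have [] := @loopP v_cnt c s (fun k s' => [/\ var s' v_pow = 2 ^ k, var s' v_i = k &
   forall j, j < k -> arr s' a_pow j = 2 ^ j]) 15 isT.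
- by split.
- move=> k s' Hk [I1 I2 I3] Fv Fa s1; split; last by apply: leq_trans (cost_loopfree _ _) _.
  have O1 : var s' v_one = 1 by rewrite Fv.
  rewrite /c /s1 /= /set_reg /= I1 O1 I2 addn1 expnS mul2n addnn; split=> // j.
  rewrite ltnS leq_eqVlt => /orP[/eqP ->|Hik]; first by rewrite eqxx.
  by rewrite (ltn_eqF Hik) I3.
by rewrite Hcnt => -[_ _ I3] Hc; split=> //; move: (cost _ _) Hc => u; clear; lia.
Qed.

Lemma c_weightP s m (a : nat -> nat) L A D (al := fun i => a i + L - A) :
  var s v_one = 1 -> var s v_i = 0 -> var s v_L = L -> var s v_max = A -> var s v_tot = 0 ->
  var s v_cnt = m -> (forall i, i < m -> arr s a_al i = a i) ->
  (forall j, j <= D -> arr s a_pow j = 2 ^ j) -> (forall i, i < m -> al i <= D) ->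
  let s' := run c_weight s in
  [/\ forall i, i < m -> arr s' a_al i = al i, forall i, i < m -> arr s' a_wt i = wt al i,
      var s' v_tot = wint al 0 m & cost c_weight s <= 50 * m.+1].
Proof.
move=> H1 Hi HL HA H0 Hcnt Ha Hp HD; rewrite /c_weight; set c := (c in Loop _ c).
have [] := @loopP v_cnt c s (fun k s' => [/\ var s' v_i = k,
   forall i, i < m -> arr s' a_al i = if i < k then al i else a i,
   forall i, i < k -> arr s' a_wt i = wt al i &
   var s' v_tot = wint al 0 k]) 40 isT.
- by split=> //; rewrite /wint big_geq.
- move=> k s' Hk [I1 I2 I3 I4] Fv Fa s1; split; last by apply: leq_trans (cost_loopfree _ _) _.
  rewrite Hcnt in Hk.
  have O1 : var s' v_one = 1 by rewrite Fv.
  have OL : var s' v_L = L by rewrite Fv.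
  have OA : var s' v_max = A by rewrite Fv.
  have Ak : arr s' a_al k = a k by rewrite I2 // ltnn.
  have Wk : arr s' a_pow (al k) = wt al k by rewrite Fa // Hp // HD.
  rewrite /c /s1 /= /set_reg /= I1 Ak OL OA O1 -/(al k) Wk I4 addn1 wint_recr //.
  split=> // i Hik.
    by rewrite ltnS [i <= k]leq_eqVlt; case: eqP => [->|_] //=; rewrite I2.
  move: Hik; rewrite ltnS leq_eqVlt => /orP[/eqP ->|Hik]; first by rewrite eqxx.
  by rewrite (ltn_eqF Hik) I3.
rewrite Hcnt => -[_ I2 I3 I4] Hc; split=> // [i Hik|]; first by rewrite I2 // Hik.
by move: (cost _ _) Hc => u; clear; lia.
Qed.

(** The [load] of the root, whose only symmetric variable is the first one; since [m >= 3] its chain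
    has an inner part of weight [W] and a last variable of weight [wl]. *)
Definition root_load w0 W wl d := w0 + 2 * d.-1 * W + 2 * wl.

Lemma c_search2P s : let s' := run c_search2 s in
  var s' v_d = if arr s a_pow (var s v_d) <
     var s v_t + var s v_w0 + var s v_wl + var s v_wl then var s v_d + var s v_one else var s v_d.
Proof. by rewrite /= /set_reg /= subn_gt0; case: ifP. Qed.

Lemma c_searchP s D w0 W wl : var s v_one = 1 -> var s v_zero = 0 -> var s v_d = 0 ->
  var s v_w0 = w0 -> var s v_tot = W -> var s v_wl = wl -> var s v_cnt = D ->
  (forall j, j <= D -> arr s a_pow j = 2 ^ j) -> root_load w0 W wl D <= 2 ^ D ->
  let d := var (run c_search s) v_d in
  [/\ root_load w0 W wl d <= 2 ^ d, forall e, e < d -> 2 ^ e < root_load w0 W wl e, d <= D &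
      cost c_search s <= (8 * D + 50) * D.+1].
Proof.
move=> H1 H0 Hd0 Hw0 HW Hwl Hcnt Hp HD; rewrite /c_search; set c := (c in Loop _ c).
have [] := @loopP v_cnt c s (fun k s' => let d := var s' v_d in [/\ d <= k,
   forall e, e < d -> 2 ^ e < root_load w0 W wl e &
   d = k \/ root_load w0 W wl d <= 2 ^ d]) (8 * D + 40) isT.
- by rewrite /= Hd0; split=> //; left.
- move=> k s' Hk [I1 I2 I3] Fv Fa s1; rewrite Hcnt in Hk.
  have O1 : var s1 v_one = 1 by rewrite /s1 /= /set_reg /= Fv.
  have O0 : var s1 v_zero = 0 by rewrite /s1 /= /set_reg /= Fv.
  have OW : var s1 v_tot = W by rewrite /s1 /= /set_reg /= Fv.
  have Ow0 : var s1 v_w0 = w0 by rewrite /s1 /= /set_reg /= Fv.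
  have Owl : var s1 v_wl = wl by rewrite /s1 /= /set_reg /= Fv.
  have Od : var s1 v_d = var s' v_d by [].
  have Oa : arr s1 a_pow = arr s a_pow by rewrite -Fa.
  rewrite /c (runSeq3 c_search1) (costSeq3 c_search1); clearbody s1.
  have C1 : cost c_search1 s1 = 2 by [].
  have E1 : var (run c_search1 s1) v_e = 2 * (var s' v_d).-1.
    by rewrite /= /set_reg /= O1 Od subn1 addnn mul2n.
  have F1 y := @frame_var c_search1 s1 y; have A1 y := @frame_arr c_search1 s1 y.
  rewrite C1; move: (run c_search1 s1) E1 F1 A1 => s2 E1 F1 A1.
  have [|T2 C2] := @c_mulP v_t v_e v_tot s2 isT isT isT isT; first by rewrite F1.
  have F2 y := @frame_var (c_mul v_t v_e v_tot) s2 y.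
  have A2 y := @frame_arr (c_mul v_t v_e v_tot) s2 y.
  move: (cost (c_mul _ _ _) s2) (run (c_mul _ _ _) s2) T2 C2 F2 A2 => u s3 T2 C2 F2 A2.
  have C3 : cost c_search2 s3 <= 15 by apply: leq_trans (cost_loopfree _ _) _.
  have := c_search2P s3; rewrite T2 A2 // A1 // Oa.
  rewrite (F2 v_d) // (F1 v_d) // (F2 v_w0) // (F1 v_w0) // (F2 v_wl) // (F1 v_wl) //.
  rewrite (F2 v_one) // (F1 v_one) // (F1 v_tot) // E1 Od O1 OW Ow0 Owl.
  move: (var s' v_d) I1 I2 I3 E1 => d I1 I2 I3 E1; rewrite Hp; last by lia.
  have -> : 2 * d.-1 * W + w0 + wl + wl = root_load w0 W wl d by rewrite /root_load; lia.
  rewrite E1 in C2; move: (run c_search2 s3) => s4 ->; split; last first.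
    by move: C3 C2 I1 Hk; clear; lia.
  case: ltnP => Hlt /=; rewrite ?addn1; split=> //.
  + by move=> e; rewrite ltnS leq_eqVlt => /orP[/eqP ->//|]; apply: I2.
  + by left; case: I3 => [->//|]; rewrite leqNgt Hlt.
  + exact: leqW.
  + by right.
rewrite Hcnt; move: (run _ s) (cost _ s) => s' u /= [I1 I2 I3] Hc; split=> //.
  by case: I3 => [->|].
by move: Hc; clear; lia.
Qed.

Lemma expn4_bound L : 0 < L -> 4 * L <= 2 ^ (2 * L).
Proof.
case: L => // L _; elim: L => // L IH.
rewrite (_ : 2 * L.+2 = 2 * L.+1 + 2); last by lia.
by rewrite expnD; apply: leq_trans (leq_mul IH (leqnn 4)); lia.
Qed.

(** All weights are at most [2^L], so the load is at most [4 L * (2 m * 2^L)]; now use [2 m <= 2^L]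
    and [4 L <= 2^(2 L)]. Thus the search may stop at [4 L], which is also the size of the power
    table. *)
Lemma root_load_bound m L al : 3 <= m -> 2 * m <= 2 ^ L -> (forall i, i < m -> al i <= L) ->
  root_load (wt al 0) (wint al 1 m.-1) (wt al m.-1) (4 * L) <= 2 ^ (4 * L).
Proof.
move=> Hm HL Hal.
have L0 : 0 < L by case: L HL {Hal} => //; rewrite expn0; lia.
have Hw i : i < m -> wt al i <= 2 ^ L by move=> Hi; rewrite /wt leq_exp2l // Hal.
have HW : wint al 1 m.-1 <= (m - 2) * 2 ^ L.
  rewrite /wint (_ : m - 2 = m.-1 - 1); last by lia.
  rewrite -sum_nat_const_nat big_nat [X in _ <= X]big_nat; apply: leq_sum => i Hi.
  by apply: Hw; lia.
have E1 : 2 ^ (4 * L) = 2 ^ (2 * L) * (2 ^ L * 2 ^ L) by rewrite -!expnD; congr (_ ^ _); lia.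
have E2 := expn4_bound L0.
have W0 : wt al 0 <= 2 ^ L by apply: Hw; lia.
have Wl : wt al m.-1 <= 2 ^ L by apply: Hw; lia.
rewrite E1; apply: leq_trans (leq_mul E2 (leqnn _)).
apply: leq_trans (leq_mul (leqnn (4 * L)) (leq_mul HL (leqnn _))).
move: (2 ^ L) W0 Wl HW => p W0 Wl HW; rewrite /root_load.
have H1 : 2 * (4 * L).-1 * wint al 1 m.-1 <= 2 * (4 * L).-1 * ((m - 2) * p).
  by rewrite leq_mul2l HW orbT.
have -> : 4 * L * (2 * m * p) = 2 * (4 * L) * ((m - 2) * p) + 4 * L * (4 * p).
  by rewrite -{1}(subnK (ltnW Hm)); lia.
have H2 : 2 * (4 * L).-1 * ((m - 2) * p) <= 2 * (4 * L) * ((m - 2) * p).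
  by rewrite leq_mul2r leq_mul2l leq_pred !orbT.
have H3 : 4 * p <= 4 * L * (4 * p) by rewrite leq_pmull // muln_gt0.
by lia.
Qed.

Definition root_item m d := Item true [:: 0] 1 m d.

Lemma c_initP m (a : nat -> nat) : 3 <= m ->
  let s := store0 (m :: [seq a i | i <- iota 0 m]) in
  let A := \max_(0 <= i < m) a i in
  exists L d, let al := fun i => a i + L - A in
  [/\ 2 * m <= 2 ^ L < 4 * m, queue_inv m L (4 * L) al (run c_init s) [:: root_item m d] [::],
      forall e, e < d -> 2 ^ e < root_load (wt al 0) (wint al 1 m.-1) (wt al m.-1) e, d <= 4 * L &
      cost c_init s <= 1000 * (m + L * L)].
Proof.
move=> Hm s A; rewrite /c_init.
rewrite (runSeq c_read0) (costSeq c_read0).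
have Z1 : var (run c_read0 s) v_one = 1 by [].
have Zm : var (run c_read0 s) v_m = m by [].
have Z3 : var (run c_read0 s) v_three = 3 by [].
have Zc : var (run c_read0 s) v_cnt = m by rewrite /= /set_reg /= addn0.
have Zi : sin (run c_read0 s) = [seq a i | i <- iota 0 m] by [].
have Zo : sout (run c_read0 s) = [::] by [].
have Zsp : var (run c_read0 s) v_sp = 1 by [].
have Za : arr (run c_read0 s) = fun _ _ => 0 by [].
have Fv0 y : y \notin [:: v_one; v_m; v_three; v_cnt; v_sp] -> var (run c_read0 s) y = 0.
  by move=> Hy; rewrite frame_var //; move: Hy; rewrite !inE; lia.
have C0 : cost c_read0 s = 5 by [].
rewrite C0; move: (run c_read0 s) Z1 Zm Z3 Zc Zi Zo Zsp Za Fv0 => s0 Z1 Zm Z3 Zc Zi Zo Zsp Za Fv0.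
rewrite (runSeq c_read) (costSeq c_read).
have [[R1 R2 R3] R4] := c_readP Z1 (Fv0 v_i isT) (Fv0 v_max isT) Zc Zi.
have Fv1 y := @frame_var c_read s0 y; have Fa1 y := @frame_arr c_read s0 y.
move: (cost c_read s0) (run c_read s0) R1 R2 R3 R4 Fv1 Fa1 => u1 s1 R1 R2 R3 R4 Fv1 Fa1.
rewrite (runSeq c_log0) (costSeq c_log0).
have C2 : cost c_log0 s1 = 3 by [].
have Fv2 y := @frame_var c_log0 s1 y; have Fa2 y := @frame_arr c_log0 s1 y.
have [_ Fo2] := @frame_io c_log0 s1 isT.
have P2 : var (run c_log0 s1) v_pow = 1 by [].
have T2 : var (run c_log0 s1) v_t3 = m + m by rewrite /= /set_reg /= Fv1 // Zm.
have N2 : var (run c_log0 s1) v_cnt = m.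
  by rewrite /= /set_reg /= (Fv1 v_m) // (Fv1 v_zero) // (Fv0 v_zero) // Zm addn0.
rewrite C2; move: (run c_log0 s1) Fv2 Fa2 Fo2 P2 T2 N2 => s2 Fv2 Fa2 Fo2 P2 T2 N2.
rewrite (runSeq c_log) (costSeq c_log).
have O2 : var s2 v_one = 1 by rewrite Fv2 // Fv1.
have L2 : var s2 v_L = 0 by rewrite Fv2 // Fv1 // Fv0.
have := c_logP Hm O2 P2 L2 T2 N2.
have Fv3 y := @frame_var c_log s2 y; have Fa3 y := @frame_arr c_log s2 y.
have [_ Fo3] := @frame_io c_log s2 isT.
move: (cost c_log s2) (run c_log s2) Fv3 Fa3 Fo3 => u3 s3 Fv3 Fa3 Fo3.
set L := var s3 v_L => -[HL C3]; set D := 4 * L.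
rewrite (runSeq c_pow0) (costSeq c_pow0).
have C4 : cost c_pow0 s3 = 5 by [].
have Fv4 y := @frame_var c_pow0 s3 y; have Fa4 y := @frame_arr c_pow0 s3 y.
have [_ Fo4] := @frame_io c_pow0 s3 isT.
have P4 : var (run c_pow0 s3) v_pow = 1 by [].
have I4 : var (run c_pow0 s3) v_i = 0 by [].
have X4 : var (run c_pow0 s3) v_x = D by rewrite /= /set_reg /= -/L /D; lia.
have N4 : var (run c_pow0 s3) v_cnt = D.+1.
  by rewrite /= /set_reg /= -/L /D (Fv3 v_one) // O2; lia.
rewrite C4; move: (run c_pow0 s3) Fv4 Fa4 Fo4 P4 I4 X4 N4 => s4 Fv4 Fa4 Fo4 P4 I4 X4 N4.
have O4 : var s4 v_one = 1 by rewrite Fv4 // Fv3.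
rewrite (runSeq c_pow) (costSeq c_pow).
have [Hpow C5] := c_powP O4 P4 I4 N4.
have Fv5 y := @frame_var c_pow s4 y; have Fa5 y := @frame_arr c_pow s4 y.
have [_ Fo5] := @frame_io c_pow s4 isT.
move: (cost c_pow s4) (run c_pow s4) Fv5 Fa5 Fo5 Hpow C5 => u5 s5 Fv5 Fa5 Fo5 Hpow C5.
rewrite (runSeq c_weight0) (costSeq c_weight0).
have C6 : cost c_weight0 s5 = 2 by [].
have Fv6 y := @frame_var c_weight0 s5 y; have Fa6 y := @frame_arr c_weight0 s5 y.
have [_ Fo6] := @frame_io c_weight0 s5 isT.
have I6 : var (run c_weight0 s5) v_i = 0 by [].
have M5 : var s5 v_m = m by rewrite Fv5 // Fv4 // Fv3 // Fv2 // Fv1.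
have Q5 : var s5 v_zero = 0 by rewrite Fv5 // Fv4 // Fv3 // Fv2 // Fv1 // Fv0.
have N6 : var (run c_weight0 s5) v_cnt = m by rewrite /= /set_reg /= M5 Q5 addn0.
rewrite C6; move: (run c_weight0 s5) Fv6 Fa6 Fo6 I6 N6 => s6 Fv6 Fa6 Fo6 I6 N6.
rewrite (runSeq c_weight) (costSeq c_weight).
set al := fun i => a i + L - A.
have HA i : i < m -> a i <= A.
  by move=> Hi; rewrite /A big_mkord; exact: (leq_bigmax (Ordinal Hi)).
have Hal i : i < m -> al i <= L by move=> /HA; rewrite /al; lia.
have HD6 i : i < m -> al i <= D by move=> /Hal; rewrite /D; lia.
have O6 : var s6 v_one = 1 by rewrite Fv6 // Fv5.
have L6 : var s6 v_L = L by rewrite Fv6 // Fv5 // Fv4.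
have A6 : var s6 v_max = A by rewrite Fv6 // Fv5 // Fv4 // Fv3 // Fv2.
have T6 : var s6 v_tot = 0 by rewrite Fv6 // Fv5 // Fv4 // Fv3 // Fv2 // Fv1 // Fv0.
have Ha6 i : i < m -> arr s6 a_al i = a i.
  by move=> Hi; rewrite Fa6 // Fa5 // Fa4 // Fa3 // Fa2 // R1.
have Hp6 j : j <= D -> arr s6 a_pow j = 2 ^ j by move=> Hj; rewrite Fa6 // Hpow.
have [Wa Ww Wt C7] := c_weightP O6 I6 L6 A6 T6 N6 Ha6 Hp6 HD6.
have Fv7 y := @frame_var c_weight s6 y; have Fa7 y := @frame_arr c_weight s6 y.
have [_ Fo7] := @frame_io c_weight s6 isT.
move: (cost c_weight s6) (run c_weight s6) Fv7 Fa7 Fo7 Wa Ww Wt C7 => u7 s7 Fv7 Fa7 Fo7 Wa Ww Wt C7.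
have {}Wa : forall i, i < m -> arr s7 a_al i = al i := Wa.
have {}Ww : forall i, i < m -> arr s7 a_wt i = wt al i := Ww.
have {}Wt : var s7 v_tot = wint al 0 m := Wt.
rewrite (runSeq c_search0) (costSeq c_search0).
have C8 : cost c_search0 s7 = 18 by [].
have Fv8 y := @frame_var c_search0 s7 y; have Fa8 y := @frame_arr c_search0 s7 y.
have [_ Fo8] := @frame_io c_search0 s7 isT.
have M7 : var s7 v_m = m by rewrite Fv7 // Fv6.
have Q7 : var s7 v_zero = 0 by rewrite Fv7 // Fv6.
have O7 : var s7 v_one = 1 by rewrite Fv7.
have X7 : var s7 v_x = D by rewrite Fv7 // Fv6 // Fv5.
have W08 : var (run c_search0 s7) v_w0 = wt al 0.
  by rewrite /= /set_reg /= Q7 Ww //; lia.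
have Wl8 : var (run c_search0 s7) v_wl = wt al m.-1.
  by rewrite /= /set_reg /= M7 O7 subn1 Ww //; lia.
have WI : wint al 0 m = wt al 0 + wint al 1 m.-1 + wt al m.-1.
  have -> : m = m.-1.+1 by lia.
  rewrite wint_recr // (@wint_cat _ 0 1) //=; last by lia.
  by rewrite {1}/wint big_nat1.
have Wt8 : var (run c_search0 s7) v_tot = wint al 1 m.-1.
  rewrite /= /set_reg /= Q7 M7 O7 subn1 Wt !Ww; [|lia|lia].
  by rewrite WI; lia.
have N8 : var (run c_search0 s7) v_cnt = D by rewrite /= /set_reg /= X7 Q7 addn0.
rewrite C8; move: (run c_search0 s7) Fv8 Fa8 Fo8 W08 Wl8 Wt8 N8 => s8 Fv8 Fa8 Fo8 W08 Wl8 Wt8 N8.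
rewrite (runSeq c_search) (costSeq c_search).
have O8 : var s8 v_one = 1 by rewrite Fv8.
have Q8 : var s8 v_zero = 0 by rewrite Fv8.
have D8 : var s8 v_d = 0 by rewrite Fv8 // Fv7 // Fv6 // Fv5 // Fv4 // Fv3 // Fv2 // Fv1 // Fv0.
have Hp8 j : j <= D -> arr s8 a_pow j = 2 ^ j by move=> Hj; rewrite Fa8 // Fa7 // Hp6.
have Hbound : root_load (wt al 0) (wint al 1 m.-1) (wt al m.-1) D <= 2 ^ D.
  by apply: root_load_bound => //; case/andP: HL.
have := c_searchP O8 Q8 D8 W08 Wt8 Wl8 N8 Hp8 Hbound.
have Fv9 y := @frame_var c_search s8 y; have Fa9 y := @frame_arr c_search s8 y.
have [_ Fo9] := @frame_io c_search s8 isT.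
move: (cost c_search s8) (run c_search s8) Fv9 Fa9 Fo9 => u9 s9 Fv9 Fa9 Fo9.
set d := var s9 v_d => -[S1 S2 S3 C9].
rewrite (runSeq c_root0) (costSeq c_root0).
have C10 : cost c_root0 s9 = 5 by [].
have Cp t : cost (c_put v_h v_one v_zero v_one v_one v_m) t = 42 by [].
have Fv10 y := @frame_var c_root0 s9 y.
have Fa10 : arr (run c_root0 s9) = arr s9 by [].
have O9 : var s9 v_one = 1 by rewrite Fv9.
have T9 : var s9 v_three = 3 by rewrite Fv9 // Fv8 // Fv7 // Fv6 // Fv5 // Fv4 // Fv3 // Fv2 // Fv1.
have Q9 : var s9 v_zero = 0 by rewrite Fv9.
have Fo10 : sout (run c_root0 s9) = [:: 3; 1].
  by rewrite /= /set_reg /= O9 T9 Fo9 Fo8 Fo7 Fo6 Fo5 Fo4 Fo3 Fo2 R3 Zo.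
have H10 : var (run c_root0 s9) v_h = 1 by [].
have T10 : var (run c_root0 s9) v_tail = 2 by [].
have D10 : var (run c_root0 s9) v_d1 = d by rewrite /= /set_reg /= Q9 addn0.
rewrite C10 Cp; move: (run c_root0 s9) Fv10 Fa10 Fo10 H10 T10 D10 => s10 Fv10 Fa10 Fo10 H10 T10 D10.
have O10 : var s10 v_one = 1 by rewrite Fv10.
have Q10 : var s10 v_zero = 0 by rewrite Fv10.
have M10 : var s10 v_m = m by rewrite Fv10 // Fv9 // Fv8.
have Sp10 : var s10 v_sp = 1.
  by rewrite Fv10 // Fv9 // Fv8 // Fv7 // Fv6 // Fv5 // Fv4 // Fv3 // Fv2 // Fv1.
have Th10 : var s10 v_three = 3 by rewrite Fv10.
have L10 : var s10 v_L = L by rewrite Fv10 // Fv9 // Fv8 // Fv7.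
have Seg10 : seg s10 0 [:: 0].
  case=> // _; rewrite Fa10 Fa9 // Fa8 // Fa7 // Fa6 // Fa5 // Fa4 // Fa3 // Fa2 // Fa1 // Za //.
have [|||||||U1 U2 U3 U4] := @c_putP v_h v_one v_zero v_one v_one v_m s10 (root_item m d);
  rewrite ?O10 ?Q10 ?M10 ?Sp10 //.
have Fap q : q \notin awrites (c_put v_h v_one v_zero v_one v_one v_m) ->
  arr (run (c_put v_h v_one v_zero v_one v_one v_m) s10) q = arr s10 q by apply: frame_arr.
have [_ Fop] := @frame_io (c_put v_h v_one v_zero v_one v_one v_m) s10 isT.
move: (run (c_put _ _ _ _ _ _) _) U1 U2 U3 U4 Fap Fop => s11 U1 U2 U3 U4 Fap Fop.
rewrite H10 in U1.
exists L, d; rewrite -[fun i => a i + L - A]/al; split=> //.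
- split=> //=.
  + split=> i Hi; rewrite Fap // Fa10 Fa9 // Fa8 //; [exact: Wa | exact: Ww |].
    by rewrite -Fa8 // Hp8.
  + by rewrite /consts U3.
  + by rewrite U3.
  + split=> //; last by rewrite Fop Fo10.
      case=> // _; split=> //; split=> //=.
        by rewrite andbT; lia.
        by rewrite leqnn andbT; lia.
      rewrite /load /= /wsum big_seq1.
      have -> : m - 1 = (m - 3).+2 by lia.
      by move: S1; rewrite /root_load; lia.
    by case=> // j; rewrite andbF.
- have L0 : 0 < L by case: (L) HL => //; rewrite expn0; lia.
  move: R4 C3 C5 C7 C9 Hm L0; rewrite /D; move: (L) => l; clear; nia.
Qed.

(** * Logarithmic estimates *)

Import Order.TTheory GRing.Theory Num.Theory.

Section Log.
Local Open Scope ring_scope.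
Variable R : realType.
Implicit Types x y : R.

Lemma ln2_gt0 : 0 < ln 2 :> R. Proof. by rewrite ln_gt0 // ltr1n. Qed.

Lemma ler_log2 x y : 0 < x -> x <= y -> log2 x <= log2 y.
Proof.
move=> x0 xy; rewrite ler_pM2r ?invr_gt0 ?ln2_gt0 // ler_ln // posrE //; exact: lt_le_trans xy.
Qed.

Lemma ltr_log2 x y : 0 < x -> 0 < y -> log2 x < log2 y -> x < y.
Proof. by move=> x0 y0; rewrite ltr_pM2r ?invr_gt0 ?ln2_gt0 // ltr_ln. Qed.

Lemma log2M x y : 0 < x -> 0 < y -> log2 (x * y) = log2 x + log2 y.
Proof. by move=> x0 y0; rewrite /log2 lnM // mulrDl. Qed.

Lemma log2V x : 0 < x -> log2 x^-1 = - log2 x.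
Proof. by move=> x0; rewrite /log2 lnV // mulNr. Qed.

Lemma log2X x n : 0 < x -> log2 (x ^+ n) = n%:R * log2 x.
Proof. by move=> x0; rewrite /log2 lnXn // [LHS]mulrnAl -[LHS]mulr_natl. Qed.

Lemma log2_2 : log2 2 = 1 :> R.
Proof. by rewrite /log2 divff // gt_eqF // ln2_gt0. Qed.

Lemma log2_1 : log2 1 = 0 :> R. Proof. by rewrite /log2 ln1 mul0r. Qed.

Lemma log2_exp2 n : log2 (2 ^+ n) = n%:R :> R.
Proof. by rewrite log2X // log2_2 mulr1. Qed.

(** Certifies rational lower bounds on logarithms by comparing powers. *)
Lemma log2_ge x p q : 0 < x -> (0 < q)%N -> 2 ^+ p <= x ^+ q -> p%:R / q%:R <= log2 x.
Proof.
move=> x0 q0 H; rewrite ler_pdivrMr ?ltr0n // mulrC -log2X // -(log2_exp2 p).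
by apply: ler_log2 H; rewrite exprn_gt0 // ltr0n.
Qed.

(** The constant is 4.3 less one: the estimates apply to the last failing value [d - 1]. *)
Definition overhead (m : nat) : R :=
  log2 (log2 m%:R) + log2 (log2 (log2 m%:R)) + 33%:R / 10%:R.

Lemma log2_98 : log2 (98%:R / 10%:R) <= 33%:R / 10%:R :> R.
Proof.
have H : (98%:R / 10%:R) ^+ 10 <= 2 ^+ 33 :> R by lra.
have x0 : 0 < 98%:R / 10%:R :> R by lra.
have := ler_log2 (exprn_gt0 10 x0) H; rewrite (log2X 10 x0) log2_exp2; lra.
Qed.

(** The triple logarithm is negative at 3, so a numerical lower bound for it is required. *)
Lemma overhead3 : 3%:R <= overhead 3.
Proof.
have H1 : 3%:R / 2%:R <= log2 3%:R :> R by apply: log2_ge => //; lra.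
have H2 : 4%:R / 7%:R <= log2 (3%:R / 2%:R) :> R by apply: log2_ge => //; lra.
have H3 : 4%:R / 7%:R <= log2 (log2 3%:R) :> R by apply: (le_trans H2); apply: ler_log2 => //; lra.
have H4 : - (17%:R / 20%:R) <= log2 (4%:R / 7%:R) :> R.
  rewrite lerNl -log2V; last by lra.
  rewrite ler_pdivlMr // mulrC -log2X; last by lra.
  by rewrite -(log2_exp2 17); apply: ler_log2; lra.
have H5 : log2 (4%:R / 7%:R) <= log2 (log2 (log2 3%:R)) :> R by apply: ler_log2 => //; lra.
rewrite /overhead; lra.
Qed.

Lemma overhead_ge m x : (4 <= m)%N -> 0 < x -> x <= log2 m%:R -> 2 <= x ->
  log2 (98%:R / 10%:R * x) + log2 (log2 x) <= overhead m.
Proof.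
move=> Hm x0 Hx x2; have l0 : 0 < log2 m%:R :> R by lra.
have lx : 1 <= log2 x by rewrite -log2_2; apply: ler_log2.
have lx2 : log2 x <= log2 (log2 m%:R) by exact: ler_log2.
have lx3 : log2 (log2 x) <= log2 (log2 (log2 m%:R)) by apply: ler_log2 => //; lra.
rewrite log2M //; last by lra.
have := log2_98; rewrite /overhead; lra.
Qed.

(** Removes the logarithms: any explicit [x0] below [2^overhead] yields a product inequality that
    arithmetic can use. *)
Lemma overhead_lt m x0 (X : R) e : (4 <= m)%N -> 0 < X -> 0 < x0 -> log2 x0 <= overhead m ->
  log2 X + overhead m < e%:R -> X * x0 < 2 ^+ e.
Proof.
move=> Hm X0 x00 H1 H2; apply: ltr_log2; rewrite ?mulr_gt0 ?exprn_gt0 //.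
by rewrite log2M // log2_exp2; lra.
Qed.

(** * Comparing the load with powers of two *)

Lemma exp2_linear (c e0 e : nat) : (2 <= e0)%N -> (c * (2 * e0.-1) <= 2 ^ e0)%N -> (e0 <= e)%N ->
  (c * (2 * e.-1) <= 2 ^ e)%N.
Proof.
move=> H0 H1; elim: e => [|e IH]; first by lia.
rewrite leq_eqVlt => /orP[/eqP <- //|]; rewrite ltnS => He.
have He2 : (2 <= e)%N by lia.
rewrite expnS; apply: leq_trans (leq_mul (leqnn 2) (IH He)).
by rewrite [X in (_ <= X)%N]mulnCA leq_mul2l; apply/orP; right; lia.
Qed.

Lemma exp2_linearR (c : nat) (X : R) m e0 e : X <= c%:R -> (2 <= e0)%N ->
  ((c + m) * (2 * e0.-1) <= 2 ^ e0)%N -> (e0 <= e)%N ->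
  (X + m%:R) * (2 * e.-1)%:R <= 2 ^+ e.
Proof.
move=> HX H0 H1 H2; have := exp2_linear H0 H1 H2.
rewrite -(ler_nat R) natrX natrM => H; apply: le_trans H.
by rewrite ler_wpM2r // natrD lerD2r.
Qed.

Lemma quadratic_exp2 n : (15 <= n)%N -> (144 * n ^ 2 <= 2 ^ n)%N.
Proof.
elim: n => // n IH; rewrite leq_eqVlt => /orP[/eqP <-|Hn].
  by lia.
have H := IH Hn; rewrite (expnS 2 n); apply: leq_trans (leq_mul (leqnn 2) H).
rewrite [X in (_ <= X)%N]mulnCA leq_mul2l -!mulnn /=; nia.
Qed.

(** After squaring, one factor [2^n] absorbs [m^4] and the other [144 n^2]. *)
Lemma no_large_gap m n : (8 <= m)%N -> (15 <= n)%N -> (m ^ 4 <= 2 ^ n)%N ->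
  (12 * m ^ 2 * n <= 2 ^ n)%N.
Proof.
move=> Hm Hn Hmn; rewrite -(@leq_exp2r _ _ 2) //.
have -> : ((12 * m ^ 2 * n) ^ 2 = m ^ 4 * (144 * n ^ 2))%N by rewrite (expnM m 2 2) -!mulnn; move: (m * m)%N => a; lia.
by rewrite -mulnn; apply: leq_mul => //; exact: quadratic_exp2.
Qed.

(** Induction reduces to the first exponent [e + 1] with [X f < 2^(e+1)], where [f = 14.7 log2 m].
    Since [m <= X / 2], the claim follows from [3 e <= f]. Otherwise [e > 4.9 log2 m], so
    [m^4 <= 2^e] and [12 m^2 e <= 2^e], while [2^e <= X f < 4 m^2 * 3 e]. *)
Lemma search_large m (X : R) e : (8 <= m)%N -> 2 * m%:R <= X -> X <= 4 * m%:R ^+ 2 ->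
  X * (147%:R / 10%:R * log2 m%:R) < 2 ^+ e -> (X + m%:R) * (2 * e.-1)%:R <= 2 ^+ e.
Proof.
move=> Hm H1 H2; set f := _ * log2 _.
have m0 : 0 < m%:R :> R by rewrite ltr0n; lia.
have l3 : 3%:R <= log2 m%:R :> R.
  by rewrite -(log2_exp2 3); apply: ler_log2; [lra | rewrite -natrX ler_nat].
elim: e => [|e IH]; first by rewrite mulr0 => _; lra.
move=> He; have [Hlt|Hge] := ltP (X * f) (2 ^+ e).
  have e2 : (2 <= e)%N.
    rewrite leqNgt; apply/negP => He2; have : 2 ^+ e <= 2 :> R.
      by rewrite -natrX ler_nat; case: e He2 {IH He Hlt} => [|[|]].
    have : 2 <= X * f by rewrite /f; nra.
    lra.
  apply: le_trans (_ : 2 * ((X + m%:R) * (2 * e.-1)%:R) <= _); last first.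
    by rewrite exprS ler_pM2l //; exact: IH.
  rewrite mulrCA ler_wpM2l //; first by lra.
  by rewrite -natrM ler_nat; lia.
have Hn : 3 * e%:R <= f.
  rewrite leNgt; apply/negP => Hf.
  have e15 : (15 <= e)%N by rewrite ltnNge; apply/negP => He'; move: Hf; rewrite -(ler_nat R) in He'; rewrite /f; lra.
  have m4 : (m ^ 4 <= 2 ^ e)%N.
    rewrite leqNgt; apply/negP => Hlt.
    have Hlt' : 2 ^+ e <= m%:R ^+ 4 :> R by rewrite -!natrX ler_nat ltnW.
    have := ler_log2 (exprn_gt0 e (ltr0Sn R 1)) Hlt'.
    rewrite log2_exp2 log2X // => H3; move: Hf; rewrite /f; lra.
  have := no_large_gap Hm e15 m4; rewrite -(ler_nat R) !natrM !natrX => H4.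
  have X0 : 0 < X by apply: lt_le_trans H1; rewrite mulr_gt0.
  have H5 : X * f < X * (3 * e%:R) by rewrite ltr_pM2l.
  have H6 : X * (3 * e%:R) <= 4 * m%:R ^+ 2 * (3 * e%:R).
    by rewrite ler_wpM2r // mulr_ge0.
  have : 4 * m%:R ^+ 2 * (3 * e%:R) = 12 * m%:R ^+ 2 * e%:R :> R by ring.
  lra.
rewrite /= natrM; apply: ltW; apply: le_lt_trans He.
have H3 : (X + m%:R) * (2 * e%:R) <= X * (3 * e%:R).
  have : 0 <= e%:R :> R by [].
  have : 0 <= (X - 2 * m%:R) * e%:R by rewrite mulr_ge0 // subr_ge0.
  lra.
apply: le_trans H3 _; rewrite ler_wpM2l //; lra.
Qed.

(* The four smallest cases leave too little room for the asymptotic estimate. *)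
Lemma search_bound m L (X : R) e : (4 <= m)%N -> (2 * m <= 2 ^ L < 4 * m)%N ->
  2 ^+ L <= X -> X <= m%:R * 2 ^+ L -> log2 X + overhead m < e%:R ->
  (X + m%:R) * (2 * e.-1)%:R <= 2 ^+ e.
Proof.
move=> Hm /andP[HL1 HL2] HX1 HX2 He.
have HXm : 2 * m%:R <= X.
  by apply: le_trans HX1; rewrite -natrX -natrM ler_nat.
have X0 : 0 < X by apply: lt_le_trans HXm; rewrite mulr_gt0 // ltr0n; lia.
have Hdiv (k : nat) : (k <= 2 ^ L)%N -> k%:R <= X.
  by move=> Hk; apply: le_trans HX1; rewrite -natrX ler_nat.
have Hmul (k : nat) : (m * 2 ^ L <= k)%N -> X <= k%:R.
  by move=> Hk; apply: le_trans HX2 _; rewrite -natrX -natrM ler_nat.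
have [m8|m8] := leqP 8 m.
  apply: search_large => //.
    apply: le_trans HX2 _; rewrite (_ : 4 * m%:R ^+ 2 = m%:R * (4 * m%:R) :> R); last by ring.
    by rewrite ler_wpM2l // -natrX -natrM ler_nat ltnW.
  have l3 : 3%:R <= log2 m%:R :> R.
    by rewrite -(log2_exp2 3); apply: ler_log2; [lra | rewrite -natrX ler_nat].
  apply: (@overhead_lt m) => //; first by rewrite mulr_gt0; lra.
  have H15 : 3%:R / 2%:R <= log2 3%:R :> R by apply: log2_ge => //; lra.
  have H16 : log2 3%:R <= log2 (log2 m%:R) :> R by apply: ler_log2 => //; lra.
  have H17 : log2 (3%:R / 2%:R) <= log2 (log2 (log2 m%:R)) :> R by apply: ler_log2; lra.
  (* The factor 9.8 comes from the constant 3.3, the factor 3/2 from the triple logarithm, since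
     [log2 log2 m >= log2 3 >= 3/2] here. *)
  have -> : 147%:R / 10%:R * log2 m%:R = 98%:R / 10%:R * (3%:R / 2%:R * log2 m%:R) :> R by lra.
  rewrite (@log2M (98%:R / 10%:R)) ?(@log2M (3%:R / 2%:R)); try lra.
  have := log2_98; rewrite /overhead; lra.
have [m5|m5] := leqP 5 m.
  have EL : (2 ^ L = 16)%N.
    case: L HL1 HL2 {HX1 HX2 Hdiv Hmul} => [|[|[|[|[|L]]]]]; rewrite ?expnS ?expn0; try lia.
  have := Hdiv 16; rewrite EL => /(_ isT) X16.
  have l225 : 9%:R / 4%:R <= log2 m%:R :> R.
    apply: log2_ge => //; first by rewrite ltr0n; lia.
    by rewrite -!natrX ler_nat; apply: (@leq_trans (5 ^ 4)) => //; rewrite leq_exp2r.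
  have l2 : 0 <= log2 (log2 (9%:R / 4%:R)) :> R.
    have : log2 2 <= log2 (9%:R / 4%:R) :> R by apply: ler_log2; lra.
    by rewrite log2_2 => /(ler_log2 ltr01); rewrite log2_1.
  (* The factor 22 is just below [9.8 * 9/4], where [9/4 <= log2 5]. *)
  have H22 : X * 22%:R < 2 ^+ e.
    apply: (@overhead_lt m) => //.
    apply: le_trans (_ : log2 (98%:R / 10%:R * (9%:R / 4%:R)) <= _); first by apply: ler_log2; lra.
    have := @overhead_ge m (9%:R / 4%:R) Hm; lra.
  have Xm : X <= 112%:R by apply: Hmul; rewrite EL; lia.
  have mR : m%:R <= 7%:R :> R by rewrite ler_nat.
  (* The crude bound [X <= 7 * 16] settles all [e >= 12], and [X >= 16] forces [e >= 9]; the three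
     values between are checked numerically. *)
  have [e12|e12] := leqP 12 e; first by apply: (@exp2_linearR 112 X m 12) => //; lia.
  have e9 : (9 <= e)%N.
    rewrite ltnNge; apply/negP => He8; have : 2 ^+ e <= 2 ^+ 8 :> R by rewrite -!natrX ler_nat leq_exp2l.
    lra.
  have : e = 9 \/ e = 10 \/ e = 11 by lia.
  by case=> [E|[E|E]]; rewrite E /= in H22 *; lra.
have E4 : m = 4 by lia.
have EL : (2 ^ L = 8)%N.
  case: L HL1 HL2 {HX1 HX2 Hdiv Hmul} => [|[|[|[|L]]]]; rewrite ?expnS ?expn0 E4; try lia.
have := Hdiv 8; rewrite EL => /(_ isT) X8.
have l4 : log2 m%:R = 2 :> R by rewrite E4 -(log2_exp2 2); congr log2; lra.
have H19 : X * (196%:R / 10%:R) < 2 ^+ e.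
  apply: (@overhead_lt m) => //; first by lra.
  have := @overhead_ge m 2 Hm; rewrite l4 log2_2 log2_1 addr0.
  rewrite (_ : 98%:R / 10%:R * 2 = 196%:R / 10%:R :> R); last by lra.
  by apply; lra.
have Xm : X <= 32%:R by apply: Hmul; rewrite EL E4.
have [e12|e12] := leqP 10 e; first by apply: (@exp2_linearR 32 X m 10) => //; rewrite E4.
have e9 : (8 <= e)%N.
  rewrite ltnNge; apply/negP => He8; have : 2 ^+ e <= 2 ^+ 7 :> R by rewrite -!natrX ler_nat leq_exp2l.
  lra.
have : e = 8 \/ e = 9 by lia.
by case=> E; rewrite E E4 /= in H19 *; lra.
Qed.

End Log.

(** * The theorem *)

Lemma chain_and_or (x : nat -> bool) (s : seq nat) : s != [::] ->
  and_or_path [seq x i | i <- s] = chain x true s /\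
  or_and_path [seq x i | i <- s] = chain x false s.
Proof.
elim: s => // i [|j s] IH _; first by rewrite /= /bop andbT orbF.
by have [] := IH isT => /= -> ->.
Qed.

(** * From the search result to the delay bound *)

Section Depth.
Variables (R : realType) (m : nat) (a : nat -> nat).
Hypothesis m3 : 3 <= m.

Let A := \max_(0 <= i < m) a i.

Lemma max_attained : exists2 i, i < m & a i = A.
Proof.
rewrite /A big_mkord; have m0 : 0 < #|'I_m| by rewrite card_ord; lia.
by have [i ->] := @bigop.eq_bigmax _ (fun i : 'I_m => a i) m0; exists i.
Qed.

Lemma le_maxA i : i < m -> a i <= A.
Proof. by move=> Hi; rewrite /A big_mkord; exact: (leq_bigmax (Ordinal Hi)). Qed.

Variable L : nat.
Let al i := a i + L - A.
Let W := \sum_(0 <= i < m) 2 ^ a i.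

(** A truncated variable gets weight 1, which exceeds its scaled weight by less than 1. Multiplying
    by [2^A] keeps the comparison in the natural numbers. *)
Lemma scaled_weight_bound : wint al 0 m * 2 ^ A <= W * 2 ^ L + m * 2 ^ A.
Proof.
have -> : m * 2 ^ A = \sum_(0 <= i < m) 2 ^ A by rewrite sum_nat_const_nat subn0.
rewrite /wint /W !big_distrl -big_split /=.
apply: leq_sum => i _; rewrite /wt -!expnD /al.
have [H|H] := leqP A (a i + L); first by rewrite subnK // leq_addr.
by rewrite (_ : a i + L - A = 0) ?leq_addl //; lia.
Qed.

Lemma total_bounds : 2 ^ A <= W <= m * 2 ^ A.
Proof.
apply/andP; split.
  have [i Hi <-] := max_attained; rewrite /W big_mkord (bigD1 (Ordinal Hi)) //=; exact: leq_addr.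
have -> : m * 2 ^ A = \sum_(0 <= i < m) 2 ^ A by rewrite sum_nat_const_nat subn0.
rewrite /W big_nat [X in _ <= X]big_nat.
by apply: leq_sum => i /andP[_ Hi]; rewrite leq_exp2l // le_maxA.
Qed.

Lemma al_le i : i < m -> al i <= L.
Proof. by move=> /le_maxA; rewrite /al; lia. Qed.

Lemma wint_split : wint al 0 m = wt al 0 + wint al 1 m.-1 + wt al m.-1.
Proof.
have Em : m = m.-1.+1 by lia.
rewrite {1}Em wint_recr // (@wint_cat al 0 1 m.-1) //; last by lia.
by rewrite {1}/wint big_nat1.
Qed.

(** The variable of largest arrival time has weight [2^L], so [L <= d]; hence the subtraction in
    [d + A - L] is not truncated. *)
Lemma root_depth_ge d :
  root_load (wt al 0) (wint al 1 m.-1) (wt al m.-1) d <= 2 ^ d -> 2 <= d /\ L <= d.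
Proof.
move=> H; have := wt_gt0 al 0; have := wt_gt0 al m.-1 => w0 wl.
have d2 : 2 <= d.
  by case: d H => [|[|d]] //; rewrite /root_load ?expn0 ?expn1; lia.
split=> //; rewrite -(@leq_exp2l 2) //; apply: leq_trans H.
have [i Hi Ei] := max_attained.
apply: (@leq_trans (wint al 0 m)).
  by rewrite /wint big_mkord (bigD1 (Ordinal Hi)) //= /wt /al Ei addKn leq_addr.
rewrite wint_split /root_load; have : 1 <= 2 * d.-1 by lia.
move: (2 * d.-1) (wint _ _ _) => c x Hc.
by have := leq_pmull x Hc; lia.
Qed.

Lemma root_load_le e : 2 <= e ->
  root_load (wt al 0) (wint al 1 m.-1) (wt al m.-1) e <= wint al 0 m * (2 * e.-1).
Proof.
move=> He; rewrite wint_split /root_load; have : 2 <= 2 * e.-1 by lia.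
move: (2 * e.-1) (wt _ _) (wint _ _ _) (wt _ _) => c x y z Hc; rewrite !mulnDl; nia.
Qed.

(** If [d] were larger, the estimates would apply to [d - 1] and show that the root load already
    fits there, against the minimality of [d]. *)
Lemma search_depth d : 0 < d -> 2 * m <= 2 ^ L < 4 * m ->
  (forall e, e < d -> 2 ^ e < root_load (wt al 0) (wint al 1 m.-1) (wt al m.-1) e) ->
  (d%:R + A%:R <= log2 W%:R + overhead R m + 1 + L%:R :> R)%R.
Proof.
move=> d0 HL Hd; rewrite leNgt; apply/negP => H.
have /andP[W1 W2] := total_bounds.
have W0 : 0 < W by apply: leq_trans W1; rewrite expn_gt0.
(* The total weight after the shift and before the truncation; its logarithm is exactly
   [log2 W + L - A]. *)
pose X : R := (W%:R * 2 ^+ L / 2 ^+ A)%R.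
have q0 : (0 < 2 ^+ A :> R)%R by rewrite exprn_gt0.
have X0 : (0 < X)%R by rewrite divr_gt0 // mulr_gt0 ?exprn_gt0 ?ltr0n.
have HX1 : (2 ^+ L <= X)%R.
  by rewrite ler_pdivlMr // mulrC ler_pM2r ?exprn_gt0 // -natrX ler_nat.
have HX2 : (X <= m%:R * 2 ^+ L)%R.
  by rewrite ler_pdivrMr // mulrAC ler_pM2r ?exprn_gt0 // -natrX -natrM ler_nat.
have lX : log2 X = (log2 W%:R + L%:R - A%:R)%R.
  rewrite /X log2M ?invr_gt0 // ?mulr_gt0 ?exprn_gt0 ?ltr0n //.
  by rewrite log2M ?exprn_gt0 ?ltr0n // log2V // !log2_exp2.
have HdX : (log2 X + overhead R m + 1 < d%:R)%R by rewrite lX; lra.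
have lL : (L%:R <= log2 X)%R.
  by rewrite -(log2_exp2 R L); apply: ler_log2; rewrite ?exprn_gt0.
case: d d0 Hd H HdX => // e _ Hd _ HdX.
have He : (log2 X + overhead R m < e%:R)%R by move: HdX; rewrite -natr1; lra.
have := Hd e (leqnn _); rewrite ltnNge => /negP; apply.
have [m4|m4] := leqP 4 m.
  have HeL : (L%:R < e%:R :> R)%R.
    apply: le_lt_trans lL _; apply: le_lt_trans He; rewrite lerDl.
    have l4 : (2 <= log2 m%:R :> R)%R.
      rewrite -(log2_exp2 R 2); apply: ler_log2; first by rewrite exprn_gt0.
      by rewrite -natrX ler_nat.
    have := @overhead_ge R m 2 m4 ltac:(lra) l4 ltac:(lra); rewrite log2_2 log2_1 addr0.
    by apply: le_trans; rewrite -(log2_1 R); apply: ler_log2 => //; lra.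
  have He2 : 2 <= e.
    rewrite ltr_nat in HeL; case: L HL HeL => [|[|l]]; rewrite ?expn0 ?expn1; lia.
  apply: leq_trans (root_load_le He2) _.
  have Hs0 := search_bound m4 HL HX1 HX2 He.
  rewrite -(ler_nat R) natrX (natrM R (wint _ _ _)); apply: le_trans Hs0; rewrite ler_wpM2r //.
  have := scaled_weight_bound; rewrite -(ler_nat R) natrD !natrM !natrX => Hs.
  by rewrite -(ler_pM2r q0) mulrDl /X divfK // gt_eqF.
(* Here [2^L = 8], so every weight is at most 8 and the load at most [16 e + 8], while [log2 X >= 3]
   and the overhead of at least 3 force [e >= 7]. *)
have E3 : m = 3 by lia.
have EL : 2 ^ L = 8.
  case: L HL => [|[|[|[|l]]]]; rewrite ?expnS ?expn0 E3; lia.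
have He7 : 7 <= e.
  rewrite ltnNge; apply/negP => He7; have : (e%:R <= 6%:R :> R)%R by rewrite ler_nat.
  have := overhead3 R; have : (log2 8 <= log2 X)%R.
    by apply: ler_log2; [lra | rewrite -EL natrX].
  have -> : (log2 8 = 3 :> R)%R by rewrite -(log2_exp2 R 3); congr log2; lra.
  by move: He; rewrite E3; lra.
have Hw i : i < 3 -> wt al i <= 8 by rewrite -EL -E3 => Hi; rewrite /wt leq_exp2l // al_le.
apply: leq_trans (_ : 16 * e + 8 <= _).
  rewrite E3 /root_load /wint big_nat1 /=.
  have := Hw 0 isT; have := Hw 1 isT; have := Hw 2 isT; move: (wt _ _) (wt _ _) (wt _ _).
  by move=> x y z; nia.
elim: e He7 {Hd HdX He} => // e IH; rewrite leq_eqVlt => /orP[/eqP <-|He].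
  by [].
by rewrite expnS; have := IH He; lia.
Qed.

End Depth.

(** * Running time *)

Lemma square_le_exp2 L : L * L <= 2 * 2 ^ L.
Proof.
have [H _] : L * L <= 2 * 2 ^ L /\ 2 * L + 1 <= 2 * 2 ^ L; last exact: H.
elim: L => // L [IH1 IH2]; rewrite expnS; split; last by lia.
by lia.
Qed.

(** The unit cost is at most [3720 L] and the root potential at most [25 L^2 m]; replacing [L^2] by
    [8 m] gives [3720 * 200 * m^2 L]. Rounding 3720 up to 4000 covers the initialization. *)
Lemma running_time_bound m L d t ci : 3 <= m -> 2 * m <= 2 ^ L < 4 * m -> d <= 4 * L ->
  t <= unit_cost L (4 * L) * pot (root_item m d) -> ci <= 1000 * (m + L * L) ->
  t + ci.+1 <= 4000 * 200 * (m * m * L).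
Proof.
move=> Hm /andP[HL1 HL2] Hd Ht Hc.
have L0 : 0 < L by case: L HL1 {HL2 Hd Ht Hc} => //; rewrite expn0; lia.
have HLL : L * L <= 8 * m by have := square_le_exp2 L; lia.
have Hpot : pot (root_item m d) <= (4 * L).+1 * (4 * L).+1 * m.
  rewrite /pot /= -mulnA; apply: leq_mul; first by rewrite ltnS.
  have : d.+1 * (m - 1) <= (4 * L).+1 * (m - 1) by rewrite leq_mul2r ltnS Hd orbT.
  have -> : (4 * L).+1 * m = (4 * L).+1 * (m - 1) + (4 * L).+1.
    by rewrite mulnBr muln1 subnK // leq_pmulr //; lia.
  by lia.
have Hpot2 : pot (root_item m d) <= 25 * (L * L) * m.
  apply: leq_trans Hpot _; rewrite leq_mul2r; apply/orP; right; nia.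
have Hu : unit_cost L (4 * L) <= 3720 * L by rewrite /unit_cost; lia.
have Ht2 : t <= 3720 * L * (25 * (8 * m) * m).
  apply: leq_trans Ht _; apply: leq_mul Hu _; apply: leq_trans Hpot2 _.
  by rewrite leq_mul2r leq_mul2l HLL !orbT.
have Hml : m <= m * m * L by rewrite -mulnA leq_pmulr // muln_gt0 L0; lia.
have Hc2 : ci <= 1000 * (m + 8 * m) by apply: leq_trans Hc _; rewrite leq_mul2l leq_add2l HLL orbT.
have Ht3 : t <= 3720 * 200 * (m * m * L) by apply: leq_trans Ht2 _; lia.
by move: (m * m * L) Hml Ht3 Hc2 => z; lia.
Qed.

Theorem theorem4p3 :
  exists (P : program) (c : nat),
  forall (R : realType) (m : nat) (a : 'I_m -> nat), (3 <= m)%N ->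
  exists (T : nat) (out : seq nat) (C : digraph m),
    [/\ outputs_within P (encode_instance a) T out,
        (T%:R <= c%:R * (m%:R ^+ 2 * log2 (m%:R : R)))%R,
        encodes out C /\ is_circuit C,
        realizes C (@and_or_fun m) &
        ((delay a C)%:R <=
           log2 ((\sum_(i < m) 2 ^ a i)%N%:R : R) + log2 (log2 (m%:R : R))
           + log2 (log2 (log2 (m%:R : R))) + 43%:R / 10%:R)%R].
Proof.
(* The factor 3 converts [L] into a logarithm: [2^L < 4 m] gives [L <= log2 m + 2 <= 3 log2 m]. *)
exists (ram_program c_init c_body v_r), (3 * (4000 * 200)) => R m a m3.
have m0 : 0 < m by lia.
pose i0 := Ordinal m0; pose a' i := a (insubd i0 i).
have insubdE (i : 'I_m) : insubd i0 (val i) = i by apply: val_inj; rewrite val_insubd ltn_ord.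
have Henc : encode_instance a = m :: [seq a' i | i <- iota 0 m].
  rewrite /encode_instance -val_enum_ord -map_comp; congr (_ :: _).
  by apply: eq_map => i /=; rewrite /a' insubdE.
have [L [d [HL Hinv Hmin HdL Hcost]]] := c_initP a' m3.
set A := \max_(0 <= i < m) a' i in Hinv Hmin; set al := fun i => a' i + L - A in Hinv Hmin.
have alL i : i < m -> al i <= L by exact: al_le.
have [t [s' [its [ch [Hrep Hinv' Hsz Hroot Ht]]]]] := c_body_loop alL Hinv isT.
have [_ _ _ _ [Hits _ _ _]] := Hinv; have [_ Hval _] := Hits 0 isT.
have [_ _ _ _ [_ Hch Hpar Hout]] := Hinv'.
have its0 : 0 < size its by case: (its) Hroot.
have Hnode i : i < size its -> node_ok m al its ch i by rewrite -Hsz; apply: Hch.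
have /= [d0 _] := valid_big Hval ltac:(rewrite /=; lia).
exists (t + (cost c_init (store0 (encode_instance a))).+1), (sout s'),
  (@tree_circuit m its ch m0); split.
- by rewrite Henc; exact: ram_programP.
- have := running_time_bound (t := t) m3 HL HdL _ Hcost; rewrite -Henc.
  have Ht' : t <= unit_cost L (4 * L) * pot (root_item m d).
    by apply: leq_trans Ht _; rewrite /queue_pot /= big_nat1.
  move=> /(_ Ht'); rewrite -(ler_nat R) => H; apply: le_trans H _.
  have HLlog : (L%:R <= 3 * log2 m%:R :> R)%R.
    have HLm : (2 ^+ L <= 2 ^+ 2 * m%:R :> R)%R.
      by rewrite -!natrX -natrM ler_nat; case/andP: HL => _ /ltnW.
    have l1 : (1 <= log2 m%:R :> R)%R.
      have : (log2 2 <= log2 m%:R :> R)%R by apply: ler_log2; rewrite ?ler_nat //; lia.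
      by rewrite log2_2.
    have := ler_log2 (exprn_gt0 L (ltr0Sn R 1)) HLm.
    rewrite log2M ?exprn_gt0 ?ltr0n // !log2_exp2; lra.
  move: (4000 * 200) => K; rewrite (natrM R K) (natrM R 3) (natrM R (m * m)) (natrM R m) -expr2.
  have C0 : (0 <= K%:R * m%:R ^+ 2 :> R)%R by rewrite mulr_ge0 ?exprn_ge0.
  have := ler_wpM2l C0 HLlog; lra.
- split; first by rewrite Hout Hsz; exact: tree_encodes Hnode.
  exact: tree_is_circuit Hnode Hpar.
- apply: (tree_realizes its0 Hnode) => x; rewrite Hroot /sem /= /and_or_fun.
  have -> : [seq x i | i <- enum 'I_m] = [seq x (insubd i0 i) | i <- iota 0 m].
    by rewrite -val_enum_ord -map_comp; apply: eq_map => i /=; rewrite insubdE.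
  rewrite (proj1 (@chain_and_or (fun i => x (insubd i0 i)) (iota 0 m) _)); last first.
    by rewrite -size_eq0 size_iota -lt0n.
  have -> : iota 0 m = 0 :: index_iota 1 m by rewrite /index_iota -{1}(subnKC m0).
  by rewrite /bigb /= andbT.
(* Undoing the shift by [A - L]; truncation has only increased the shifted arrival times, so the
   bound survives it. *)
- have HB : delay a (@tree_circuit m its ch m0) <= d + A - L.
    apply: (tree_delay m0 its0 Hnode Hpar) => i; rewrite Hroot /= /al /a' insubdE; lia.
  have Hload : root_load (wt al 0) (wint al 1 m.-1) (wt al m.-1) d <= 2 ^ d.
    case: Hval => _ _ _ _; rewrite /load /= /wsum big_seq1 (_ : m - 1 = (m - 3).+2); last by lia.
    by rewrite /root_load addnA.
  have [_ HLd] := root_depth_ge m3 Hload.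
  have := search_depth R m3 d0 HL Hmin.
  have HBR : ((delay a (@tree_circuit m its ch m0))%:R <= d%:R + A%:R - L%:R :> R)%R.
    by rewrite -natrD -natrB ?ler_nat //; apply: leq_trans (leq_addr _ _).
  have -> : \sum_(0 <= i < m) 2 ^ a' i = \sum_(i < m) 2 ^ a i.
    by rewrite big_mkord; apply: eq_bigr => i _; rewrite /a' insubdE.
  rewrite /overhead; lra.
Qed.
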